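(* Let $T\subset[0,\infty)$ be locally finite. If $0\in T$ and $0<D^-(T)\le D^+(T)<\infty$, then $T\in\mathfrak U$.
   Context: $\mathbb N=\{0,1,2,\dots\}$. A set $T\subset[0,\infty)$ is locally finite if $T\cap[0,R]$ is finite for every $R>0$. The lower and upper Beurling densities on the half line are $$D^-(T)=\liminf_{R\to\infty}\inf_{x\ge0}\frac{\#(T\cap[x,x+R])}{R},\qquad D^+(T)=\limsup_{R\to\infty}\sup_{x\ge0}\frac{\#(T\cap[x,x+R])}{R}.$$ For a positive operator $A$ on a Hilbert space, $A^t$ is defined by continuous functional calculus for $t>0$ and $A^0=I$. The family $\{CA^t\}_{t\in T}$ is exactly observable if there are $0<a\le b<\infty$ with $a\|x\|^2\le\sum_{t\in T}\|CA^tx\|^2\le b\|x\|^2$ for all $x\in H$. $\mathfrak U$ is the class of universal time sets: locally finite $T\subset[0,\infty)$ such that for all separable complex Hilbert spaces $H,Y$, every positive $A\in\mathcal B(H)$ and every $C\in\mathcal B(H,Y)$, exact observability of $\{CA^n\}_{n\in\mathbb N}$ implies exact observability of $\{CA^t\}_{t\in T}$. *)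

(* Defs.v *)
From HB Require Import structures.
From mathcomp Require Import all_boot all_order all_algebra.
From mathcomp Require Import all_classical all_reals all_analysis.
From mathcomp Require Import complex.

Set Implicit Arguments.
Unset Strict Implicit.
Unset Printing Implicit Defensive.

Import Order.TTheory GRing.Theory Num.Theory.
Import numFieldNormedType.Exports.

Local Open Scope classical_set_scope.
Local Open Scope ring_scope.
Local Open Scope complex_scope.

(* Complex Hilbert spaces. The inner product is linear in its first argument
   and conjugate-linear in the second one. *)
HB.mixin Record CompleteNormedModule_isHilbert (R : realType) V
    of CompleteNormedModule R[i] V := {
  inner : {dot V for (@Num.conj R[i])} ;
  sqr_normr_inner : forall x : V, `|x| ^+ 2 = inner x x
}.

#[short(type="hilbertType")]
HB.structure Definition Hilbert (R : realType) :=
  { V of CompleteNormedModule R[i] V & CompleteNormedModule_isHilbert R V }.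

Section Operators.
Context {R : realType}.
Implicit Types H Y : hilbertType R.

(* The norm of a normed module over R[i] is an element of R[i]. *)
Definition hnorm H (x : H) : R := complex.Re `|x|.

Definition separable H : Prop := exists2 D : set H, countable D & dense D.

(* The order of R[i] is such that 0 <= z means that z is real and nonnegative;
   the spaces being complex, this includes the self-adjointness of A. *)
Definition positive_operator H (A : {linear H -> H}) : Prop :=
  continuous A /\ forall x : H, 0 <= inner (A x) x.

Definition spectrum H (A : {linear H -> H}) : set R[i] :=
  [set l | ~ exists B : {linear H -> H},
     [/\ continuous B,
         forall x, B (A x - l *: x) = x &
         forall x, A (B x) - l *: B x = x]].

Definition poly_op H (A : {linear H -> H}) (p : {poly R[i]}) (x : H) : H :=
  \sum_(i < size p) p`_i *: iter i A x.

(* B is the operator-norm limit of p_n(A) for some polynomials p_n that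
   converge to f uniformly on the spectrum of A. *)
Definition is_cfc H (A : {linear H -> H}) (f : R[i] -> R[i]) (B : H -> H) :
    Prop :=
  exists p : nat -> {poly R[i]},
    (forall e : R, 0 < e -> \forall n \near \oo,
       forall l, spectrum A l -> `|(p n).[l] - f l| <= e%:C) /\
    (forall e : R, 0 < e -> \forall n \near \oo,
       forall x, hnorm (poly_op A (p n) x - B x) <= e * hnorm x).

(* f(A). When A is self-adjoint and f is continuous on the spectrum of A, there
   is exactly one B such that is_cfc A f B; the value 0 given when there is no
   such B is then irrelevant. *)
Definition cfc H (A : {linear H -> H}) (f : R[i] -> R[i]) : H -> H :=
  xget (fun=> 0) [set B | is_cfc A f B].

(* The spectrum of a positive operator is contained in [0, +oo[. *)
Definition op_power H (A : {linear H -> H}) (t : R) : H -> H :=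
  if t == 0 then id else cfc A (fun z => (complex.Re z `^ t)%:C).

Definition exactly_observable H Y (A : {linear H -> H}) (C : {linear H -> Y})
    (T : set R) : Prop :=
  exists a b : R, [/\ 0 < a, a <= b &
    forall x : H,
      ((a * hnorm x ^+ 2)%:E
         <= \esum_(t in T) (hnorm (C (op_power A t x)) ^+ 2)%:E
         <= (b * hnorm x ^+ 2)%:E)%E].

End Operators.

Section TimeSets.
Context {R : realType}.
Implicit Types T : set R.

Definition locally_finite T : Prop :=
  forall r : R, 0 < r -> finite_set (T `&` `[0, r]).

Definition window_density T (r x : R) : \bar R :=
  (counting (T `&` `[x, (x + r)%R]) * (r^-1)%:E)%E.

Definition lower_density T : \bar R :=
  limf_einf (fun r : R => ereal_inf [set window_density T r x | x in `[0, +oo[])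
    +oo.

Definition upper_density T : \bar R :=
  limf_esup (fun r : R => ereal_sup [set window_density T r x | x in `[0, +oo[])
    +oo.

Definition naturals : set R := [set n%:R | n in [set: nat]].

Definition universal_time_set T : Prop :=
  [/\ T `<=` `[0, +oo[, locally_finite T &
    forall (H Y : hilbertType R) (A : {linear H -> H}) (C : {linear H -> Y}),
      separable H -> separable Y ->
      positive_operator A -> continuous C ->
      exactly_observable A C naturals -> exactly_observable A C T].

End TimeSets.

(* Main.v *)
From HB Require Import structures.
Require Import Defs.
From mathcomp Require Import all_boot all_order all_algebra.
From mathcomp Require Import all_classical all_reals all_analysis.
From mathcomp Require Import complex ring lra zify.

(* After [power_bounded_contraction] the operator [A] is a positive contraction,
   so the functional calculus lives on [0, 1]. Expanding [A^(N s)] in powers of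
   [1 - A^N] by the binomial series, with coefficients dominated uniformly for
   [s] in [1/2, 1] by a summable sequence, transfers the Bessel bound for
   [(C A^n)] to sums of [|C (A^n - A^t) x|^2] with [t - n] in [N/2, N], at the
   cost of a factor [sup |l^n0 (1 - l^N)|^2 <= (N / (n0 + 1))^2] when only
   [n >= n0] occur. This gives the upper bound along [T], and also shows that
   the tail [n >= n0] of the observation is controlled by [T] up to a small
   multiple of [|x|^2], since [T] has a point in each [n + N/2, n + N]. The
   finitely many remaining [n > 0] are handled one at a time: by Muntz's theorem,
   [l^n] is a uniform limit on [0, 1] of combinations of [l^t], [t] in [T],
   because positive lower density makes [sum 1/t] diverge. The time [0] is in
   [T]. *)

Set Implicit Arguments.
Unset Strict Implicit.
Unset Printing Implicit Defensive.

Import Order.TTheory GRing.Theory Num.Theory.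
Import numFieldNormedType.Exports.

Local Open Scope classical_set_scope.
Local Open Scope ring_scope.
Local Open Scope complex_scope.

(** * Approximation of powers on the unit interval *)

Section RealApproximation.
Context {R : realType}.
Implicit Types (x s t q : R) (k n : nat).

(** Comparing [C A^t x] with [C A^n x] one time after another costs a multiple of [|x|] each, and
    these costs do not sum. In the binomial expansion, the terms [A^n (1 - A^N)^k] with [k] fixed
    are instead summed over [n] by the Bessel bound of a single vector. The parameter [s] must stay
    away from [0]: over all of []0, 1]] the suprema of the coefficients are of order
    [1 / (k log k)], which is not summable. In the lower bound the order of choices matters. Muntz
    approximation comes with constants that are not uniform in the exponent, so the cut [n0] is
    fixed by the tail, and only then the accuracy for the finitely many exponents below it. The
    errors of both scalar approximations satisfy a first order equation that becomes
    [g' + tau g = r] under [x = e^(-y)], so one Gronwall estimate serves for both. *)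

Lemma is_derive_expRM a x :
  is_derive x 1 (fun y => expR (a * y)) (a * expR (a * x)).
Proof.
have -> : (fun y => expR (a * y)) = expR \o (a \*: id) by [].
apply: is_derive_eq; rewrite /GRing.scale/= mulr1 mulrC//.
Qed.

(** The hypothesis says that [expR (tau * s) * (kappa - g s)] is nondecreasing for [s >= 0], and
    this function starts at [kappa >= 0]. *)
Lemma gronwall_le (g dg : R -> R) (tau kappa : R) :
  0 <= kappa -> g 0 = 0 ->
  (forall s, is_derive s 1 g (dg s)) ->
  (forall s, 0 <= s -> tau * g s + dg s <= tau * kappa) ->
  forall s, 0 <= s -> g s <= kappa.
Proof.
move=> k0 g0 gd gle s s0.
pose h t := expR (tau * t) * (kappa - g t).
have hd t : is_derive t 1 h (expR (tau * t) * (tau * kappa - (tau * g t + dg t))).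
  have gdt := gd t; have edt := is_derive_expRM tau t.
  have -> : h = (fun y => expR (tau * y)) * (cst kappa - g) by [].
  apply: is_derive_eq.
  rewrite !fctE; rewrite /GRing.scale/=. ring.
suff : h 0 <= h s.
  rewrite /h mulr0 expR0 mul1r g0 subr0 => /(le_trans k0).
  by rewrite pmulr_rge0 ?expR_gt0// subr_ge0.
apply: (@ger0_derive1_ndecr _ h 0 s) => //.
- move=> x; rewrite in_itv/= => /andP[x0 _].
  have hdx := hd x; rewrite derive1E derive_val.
  by rewrite mulr_ge0 ?expR_ge0// subr_ge0 gle// ltW.
- apply: derivable_within_continuous => x _; by have [] := hd x.
Qed.

Lemma gronwall_norm_le (g dg : R -> R) (tau kappa : R) :
  0 < tau -> g 0 = 0 ->
  (forall s, is_derive s 1 g (dg s)) ->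
  (forall s, 0 <= s -> `|tau * g s + dg s| <= tau * kappa) ->
  forall s, 0 <= s -> `|g s| <= kappa.
Proof.
move=> t0 g0 gd gle s s0.
have k0 : 0 <= kappa.
  by rewrite -(pmulr_rge0 _ t0) (le_trans _ (gle 0 _)).
rewrite ler_norml lerNl; apply/andP; split.
  apply: (@gronwall_le (fun t => - g t) (fun t => - dg t) tau kappa) => //.
    by rewrite g0 oppr0.
  move=> t t1; rewrite mulrN -opprD (le_trans (ler_norm _))// normrN gle//.
apply: (@gronwall_le g dg tau kappa) => // t t1.
by rewrite (le_trans (ler_norm _))// gle.
Qed.

(* [binc s k] is the coefficient of [u ^+ k] in the binomial series of
   [(1 - u) `^ s], and [binp s K] is the [K]-th partial sum. *)
Fixpoint binc s k : R :=
  if k is k'.+1 then binc s k' * (k'%:R - s) / k%:R else 1.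

Definition binp s K : {poly R} := \sum_(k < K.+1) binc s k *: 'X^k.

(** For [0 < s <= 1] this is the uniform error of the [K]-th partial sum on [[0, 1]], attained at
    [u = 1]. *)
Definition binprod s K : R := \prod_(j < K) (1 - s / j.+1%:R).

Arguments binc : simpl never.

Lemma binc_rec s k : binc s k.+1 = binc s k * (k%:R - s) / k.+1%:R.
Proof. by []. Qed.

Lemma binc_binprod s K : (K%:R - s) * binc s K = - s * binprod s K.
Proof.
elim: K => [|K IH]; first by rewrite /binprod big_ord0 sub0r.
rewrite /binprod big_ord_recr/= -/(binprod s K) mulrA -IH binc_rec.
by field; rewrite nat1r pnatr_eq0.
Qed.

Lemma bincS s K : binc s K.+1 = - (s * binprod s K / K.+1%:R).
Proof. by rewrite binc_rec [_ * (_ - s)]mulrC binc_binprod !mulNr. Qed.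

(** The function [(1 - u)^s] solves [(1 - u) f' + s f = 0]. For the partial sum, the recurrence of
    the coefficients cancels every degree below [K] and leaves one monomial. *)
Lemma binp_ode s K :
  (1 - 'X) * (binp s K)^`() + s *: binp s K = (s * binprod s K) *: 'X^K.
Proof.
rewrite -[s * _]opprK -mulNr -binc_binprod.
elim: K => [|K IH].
  rewrite /binp big_ord1/= derivZ expr0 -polyC1 derivC scaler0 mulr0 add0r.
  by rewrite -!mul_polyC -!polyCM; congr (_ %:P); ring.
rewrite /binp big_ord_recr/= -/(binp s K) derivD scalerDr mulrDr.
rewrite addrACA IH derivZ derivXn/=.
have E : (binc s K.+1)%:P * K.+1%:R = (K%:R - s%:P) * (binc s K)%:P.
  rewrite -!polyC_natr -polyCB -!polyCM; congr (_%:P).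
  by rewrite binc_rec divfK ?pnatr_eq0// mulrC.
move: E {IH}; move: (binc s K.+1) (binc s K) => c' c E.
rewrite -['X^K *+ _]mulr_natl exprS -!mul_polyC !(polyCN, polyCM, polyCB) !polyC_natr.
move: (K.+1%:R) (K%:R) E => N k E; rewrite -E; ring.
Qed.

Lemma binp1 s K : s != 0 -> (binp s K).[1] = binprod s K.
Proof.
move=> s0; have /(congr1 (horner^~ 1)) := binp_ode s K.
by rewrite !hornerE subrr mul0r add0r expr1n mulr1 => /(mulfI s0).
Qed.

Lemma binp0 s K : (binp s K).[0] = 1.
Proof.
rewrite /binp horner_sum big_ord_recl/= hornerZ hornerXn expr0 mulr1.
by rewrite big1 ?addr0// => i _; rewrite hornerZ hornerXn expr0n mulr0.
Qed.

Lemma binprod_ge0 s K : 0 <= s <= 1 -> 0 <= binprod s K.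
Proof.
move=> /andP[s0 s1]; apply: prodr_ge0 => i _.
rewrite subr_ge0 ler_pdivrMr// mul1r (le_trans s1)// ler1n//.
Qed.

Lemma binprod_le s n m : 0 <= s <= 1 -> (n <= m)%N -> binprod s m <= binprod s n.
Proof.
move=> s01 /subnKC <-; elim: (m - n)%N => [|k IH]; first by rewrite addn0.
rewrite addnS (le_trans _ IH)// {1}/binprod big_ord_recr/= -/(binprod s _).
rewrite ler_piMr ?binprod_ge0// gerBl divr_ge0//.
by case/andP: s01.
Qed.

Lemma powR_expRN x s : powR (expR (- x)) s = expR (- s * x).
Proof.
by rewrite /powR gt_eqF ?expR_gt0// expRK mulrN mulNr.
Qed.

Lemma expRN_onto x : 0 < x <= 1 -> exists2 t, 0 <= t & x = expR (- t).
Proof.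
move=> /andP[x0 x1]; exists (- ln x); last by rewrite opprK lnK// posrE.
by rewrite oppr_ge0 ln_le0.
Qed.

(** With [x = e^(-y)] and [u = 1 - x], [binp_ode] says that the error [g] satisfies
    [s g + g' = s * binprod s K * u^K], and [g] vanishes at [y = 0]. The substitution misses
    [x = 0], where [binp1] gives the error. *)
Lemma binp_powR s K x : 0 < s <= 1 -> 0 <= x <= 1 ->
  `|(binp s K).[1 - x] - x `^ s| <= binprod s K.
Proof.
move=> /andP[s0 s1]; have B0 : 0 <= binprod s K by rewrite binprod_ge0// ltW.
rewrite le_eqVlt => /andP[/predU1P[<- _|x0 x1]].
  by rewrite subr0 binp1 ?gt_eqF// powR0 ?gt_eqF// subr0 ger0_norm.
have [|t t0 ->] := @expRN_onto x; first by rewrite x0.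
rewrite powR_expRN.
pose g y := (binp s K).[1 - expR (- 1 * y)] - expR (- s * y).
pose dg y := ((binp s K)^`()).[1 - expR (- 1 * y)] * expR (- 1 * y) + s * expR (- s * y).
rewrite -[- t]mulN1r -/(g t).
apply: (@gronwall_norm_le g dg s) => //.
- by rewrite /g !mulr0 expR0 subrr binp0 subrr.
- move=> y; have e1 := is_derive_expRM (- 1) y; have e2 := is_derive_expRM (- s) y.
  have -> : g = (horner (binp s K) \o (cst 1 - (fun y => expR (- 1 * y))))
     - (fun y => expR (- s * y)) by [].
  apply: is_derive_eq; rewrite !fctE; rewrite /dg; ring.
- move=> y y0; set u := 1 - expR (- 1 * y).
  have u01 : 0 <= u <= 1.
    rewrite /u subr_ge0 lerBlDr lerDl expR_ge0 andbT.
    by rewrite -[leRHS]expR0 ler_expR mulN1r oppr_le0.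
  have E : (1 - u) * (binp s K)^`().[u] + s * (binp s K).[u]
      = s * binprod s K * u ^+ K.
    by have /(congr1 (horner^~ u)) := binp_ode s K; rewrite !hornerE.
  have -> : s * g y + dg y = s * binprod s K * u ^+ K.
    by rewrite -E /dg /g -/u /u; ring.
  rewrite !normrM (ger0_norm B0) (gtr0_norm s0) ler_piMr ?mulr_ge0// ?(ltW s0)//.
  case/andP: u01 => u0 u1; rewrite normrX ger0_norm//.
  exact: exprn_ile1.
Qed.

(** Apart from the factor [s <= 1], the modulus of the coefficient decreases with [s], so [1/2] is
    the worst case. *)
Lemma binc_bound s k : 2^-1 <= s <= 1 ->
  `|binc s k.+1| <= binprod 2^-1 k / k.+1%:R.
Proof.
move=> /andP[s2 s1]; have s0 : 0 < s by rewrite (lt_le_trans _ s2).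
rewrite bincS normrN !normrM (gtr0_norm s0) [X in _ * X]ger0_norm//.
rewrite ler_pM2r ?invr_gt0// ger0_norm ?binprod_ge0 ?(ltW s0)//.
apply: (@le_trans _ _ (binprod s k)).
  by rewrite ler_piMl// binprod_ge0// (ltW s0).
apply: ler_prod => i _; apply/andP; split.
  by rewrite subr_ge0 ler_pdivrMr// mul1r (le_trans s1)// ler1n.
by rewrite lerD2l lerN2 ler_pM2r// invr_gt0.
Qed.

(** For [s = 1/2] all coefficients after the first are nonpositive, and the partial sum at [u = 1]
    is [binprod 2^-1 K >= 0]; so their moduli add up to at most [1]. The terms here are twice these
    moduli. *)
Lemma sum_binc_bound K : \sum_(k < K) binprod 2^-1 k / k.+1%:R <= 2 :> R.
Proof.
have h : (2^-1 : R) != 0 by rewrite invr_eq0.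
have E : binprod 2^-1 K - 1 = \sum_(k < K) binc 2^-1 k.+1.
  rewrite -(binp1 K h) /binp horner_sum big_ord_recl hornerZ hornerXn mulr1.
  rewrite addrAC subrr add0r; apply: eq_bigr => i _.
  by rewrite hornerZ hornerXn expr1n mulr1 lift0.
have : -1 <= binprod 2^-1 K - 1 :> R.
  by rewrite lerBrDr addrC subrr binprod_ge0// invr_ge0 invf_le1//= ler1n ler0n.
rewrite E -lerN2 opprK -sumrN => le1.
apply: (@le_trans _ _ (2 * \sum_(k < K) - binc 2^-1 k.+1)); last first.
  by rewrite -[leRHS]mulr1 ler_wpM2l.
rewrite mulr_sumr.
apply: ler_sum => i _.
rewrite bincS opprK !mulrA mulfV ?mul1r//.
Qed.

(** The induction step is [(1 - a) (1 + S + b) <= 1 + S] for [0 <= b <= a <= 1] and [S >= 0]. *)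
Lemma prod_le_harmonic (a : R ^nat) (d : R) K : 0 <= d ->
  (forall j, d / j.+1%:R <= a j <= 1) ->
  (\prod_(j < K) (1 - a j)) * (1 + d * series harmonic K) <= 1.
Proof.
move=> d0 ha; elim: K => [|K IH].
  by rewrite big_ord0 /series/= big_geq// mulr0 addr0 mulr1.
rewrite big_ord_recr/=; set P := \prod_(i < K) _ in IH *.
have P0 : 0 <= P by apply: prodr_ge0 => i _; rewrite subr_ge0; have /andP[] := ha i.
have /andP[a1 a2] := ha K.
have h0 : 0 <= series (@harmonic R) K.
  by rewrite /series/=; apply: sumr_ge0 => i _; rewrite invr_ge0.
have -> : series harmonic K.+1 = series harmonic K + K.+1%:R^-1 :> R by rewrite seriesSr.
rewrite (le_trans _ IH)// -mulrA ler_wpM2l//.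
have := a1; set b := d / _ => a1'.
have b0 : 0 <= b by rewrite divr_ge0.
rewrite [d * (_ + _)]mulrDr -/b; set S := d * series _ _.
have S0 : 0 <= S by rewrite mulr_ge0.
by nra.
Qed.

(** Used for the binomial error, with [a j = s / (j + 1)], and for the Muntz product, with
    [a j = n / t j]. *)
Lemma prod_cvg0 (a : R ^nat) (d : R) : 0 < d ->
  (forall j, d / j.+1%:R <= a j <= 1) ->
  (\prod_(j < K) (1 - a j)) @[K --> \oo] --> 0.
Proof.
move=> d0 ha; have P0 K : 0 <= \prod_(j < K) (1 - a j).
  by apply: prodr_ge0 => i _; rewrite subr_ge0; have /andP[] := ha i.
have hS : series (@harmonic R) @ \oo --> +oo.
  have := @dvg_harmonic R; apply: contra_notP => H.
  have hnd : nondecreasing_seq (series (@harmonic R)).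
    by apply/nondecreasing_seqP => n; rewrite seriesSr lerDl invr_ge0.
  apply: contra_notP H => H; apply: (nondecreasing_dvgn_lt hnd) => //.
apply/cvgrPdist_le => e e0.
have /cvgryPge/(_ ((d * e)^-1)) := hS.
apply: filterS => K HK; rewrite sub0r normrN ger0_norm//.
have := prod_le_harmonic K (ltW d0) ha; have := P0 K.
set P := \prod_(_ < _) _ => Pge0 H.
have H1 : P * (d * series harmonic K) <= 1.
  by rewrite (le_trans _ H)// ler_wpM2l// lerDr.
have H2 : e^-1 <= d * series harmonic K.
  by rewrite -ler_pdivrMl// -invfM.
have : P * e^-1 <= 1 by rewrite (le_trans _ H1)// ler_wpM2l.
by rewrite ler_pdivrMr// mul1r.
Qed.

Lemma binprod_cvg0 s : 0 < s <= 1 -> binprod s K @[K --> \oo] --> 0.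
Proof.
move=> /andP[s0 s1]; apply: (@prod_cvg0 (fun j => s / j.+1%:R) s) => // j.
by rewrite lexx/= ler_pdivrMr// mul1r (le_trans s1)// ler1n.
Qed.

(** Obtained by writing [x^(N s)] as [(1 - (1 - x^N))^s], which reaches large exponents while [s]
    stays in []0, 1]]. *)
Definition powp N s K : {poly R} := binp s K \Po (1 - 'X^N).

Lemma powp_powR N s K x : 0 < s <= 1 -> 0 <= x <= 1 ->
  `|(powp N s K).[x] - x `^ (N%:R * s)| <= binprod s K.
Proof.
move=> s01 /andP[x0 x1]; rewrite horner_comp !hornerE powRrM powR_mulrn//.
by apply: binp_powR => //; rewrite exprn_ge0//= exprn_ile1.
Qed.

(* If [Q] is the approximation error obtained for the exponents [ts], the error
   [Q'] for [t :: ts] is the solution with [Q' 1 = 0] of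
   [x Q'(x)' = t Q' - (t - q) Q]. *)
Lemma muntz_bound q (ts : seq R) : 0 < q -> uniq ts -> q \notin ts ->
  (forall t, t \in ts -> 0 < t) ->
  exists a : R -> R, forall x, 0 <= x <= 1 ->
    `|x `^ q - \sum_(t <- ts) a t * x `^ t| <= \prod_(t <- ts) `|1 - q / t|.
Proof.
move=> q0; elim: ts => [|t ts IH].
  move=> _ _ _; exists (fun=> 0) => x /andP[x0 x1].
  rewrite !big_nil subr0 ger0_norm ?powR_ge0//.
  have := @ge0_ler_powR R q (ltW q0) x 1; rewrite !nnegrE powR1; exact.
rewrite /= => /andP[tts uts]; rewrite in_cons negb_or => /andP[qt qts] ts0.
have [|a ha] := IH uts qts; first by move=> y yts; rewrite ts0// in_cons yts orbT.
have t0 : 0 < t by rewrite ts0// mem_head.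
(* Comparing the coefficients of [x^e] in the equation for [Q'] gives [a1]. The coefficient of [x^t]
   is left free by the equation and is fixed by [Q' 1 = 0]. *)
pose a1 e := a e * (t - q) / (t - e).
pose a' e := if e == t then 1 - \sum_(e <- ts) a1 e else a1 e.
have a'E (F : R -> R) : \sum_(e <- t :: ts) a' e * F e =
    (1 - \sum_(e <- ts) a1 e) * F t + \sum_(e <- ts) a1 e * F e.
  rewrite big_cons /a' eqxx; congr (_ + _); apply: eq_big_seq => e ets.
  by case: eqP ets tts => // -> ->.
exists a' => x /andP[]; rewrite a'E big_cons le_eqVlt => /predU1P[<-|x0] x1.
  have -> : \sum_(e <- ts) a1 e * 0 `^ e = 0.
    rewrite big_seq big1// => e ets.
    by rewrite powR0 ?mulr0// gt_eqF// ts0// in_cons ets orbT.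
  rewrite !powR0 ?gt_eqF// mulr0 addr0 subr0 normr0 mulr_ge0//.
  by apply: prodr_ge0.
have [|y y0 ->] := @expRN_onto x; first by rewrite x0.
rewrite !powR_expRN.
rewrite (_ : \sum_(e <- ts) a1 e * _ = \sum_(e <- ts) a1 e * expR (- e * y)); last first.
  by apply: eq_bigr => e _; rewrite powR_expRN.
set kappa := _ * \prod_(_ <- _) _.
pose g (z : R) : R := expR (- q * z) - ((1 - \sum_(e <- ts) a1 e) * expR (- t * z)
  + \sum_(e <- ts) a1 e * expR (- e * z)).
pose dg (z : R) : R := - q * expR (- q * z)
  - ((1 - \sum_(e <- ts) a1 e) * (- t * expR (- t * z))
  + \sum_(e <- ts) a1 e * (- e * expR (- e * z))).
have g0 : g 0 = 0.
  rewrite /g (_ : \sum_(e <- ts) a1 e * expR (- e * 0) = \sum_(e <- ts) a1 e).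
    by rewrite !mulr0 expR0 mulr1 subrK subrr.
  by apply: eq_bigr => e _; rewrite mulr0 expR0 mulr1.
have gd : forall z : R, is_derive z (1 : R) g (dg z : R).
  move=> z.
  have hs (r : seq R) : is_derive z 1 (fun z => \sum_(e <- r) a1 e * expR (- e * z))
      (\sum_(e <- r) a1 e * (- e * expR (- e * z))).
    elim: r => [|e r IHr].
      under eq_fun do rewrite big_nil; rewrite big_nil; exact: is_derive_cst.
    under eq_fun do rewrite big_cons; rewrite big_cons.
    have e1 := is_derive_expRM (- e) z.
    have -> : (fun y => a1 e * expR (- e * y) + \sum_(j <- r) a1 j * expR (- j * y))
      = a1 e *: (fun y => expR (- e * y)) + (fun y => \sum_(j <- r) a1 j * expR (- j * y)) by [].
    exact: is_derive_eq.
  have hts := hs ts; have e1 := is_derive_expRM (- q) z.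
  have e2 := is_derive_expRM (- t) z.
  have -> : g = (fun y => expR (- q * y)) - ((1 - \sum_(e <- ts) a1 e) *: (fun y => expR (- t * y)) +
    (fun z => \sum_(e <- ts) a1 e * expR (- e * z))) by [].
  exact: is_derive_eq.
suff gle z : 0 <= z -> `|t * g z + dg z| <= t * kappa.
  exact: (gronwall_norm_le t0 g0 gd gle y0).
move=> z0.
have -> : t * g z + dg z = (t - q) * (expR (- q * z) - \sum_(e <- ts) a e * expR (- e * z)).
  rewrite /g /dg.
  have -> : \sum_(e <- ts) a1 e * (- e * expR (- e * z)) =
     (t - q) * \sum_(e <- ts) a e * expR (- e * z) - t * \sum_(e <- ts) a1 e * expR (- e * z).
    rewrite !mulr_sumr -sumrB; apply: eq_big_seq => e ets.
    have te : t - e != 0 by rewrite subr_eq0; apply: contraNneq tts => ->.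
    by rewrite /a1; field.
  ring.
have -> : t * kappa = `|t - q| * \prod_(e <- ts) `|1 - q / e|.
  rewrite /kappa mulrA; congr (_ * _).
  by rewrite -[X in X * _](gtr0_norm t0) -normrM mulrBr mulr1 mulrCA mulfV ?gt_eqF// mulr1.
rewrite normrM ler_wpM2l//.
rewrite (_ : \sum_(e <- ts) a e * _ = \sum_(e <- ts) a e * expR (- z) `^ e).
  rewrite -powR_expRN; apply: ha.
  by rewrite expR_ge0 -[leRHS]expR0 ler_expR oppr_le0.
by apply: eq_bigr => e _; rewrite powR_expRN.
Qed.

End RealApproximation.

(** * Norm and inner product of a Hilbert space *)

Section ComplexParts.
Context {R : realType}.
Implicit Types (z w : R[i]) (a : R).

Lemma ReD z w : complex.Re (z + w) = complex.Re z + complex.Re w.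
Proof. by case: z; case: w. Qed.

Lemma ReN z : complex.Re (- z) = - complex.Re z.
Proof. by case: z. Qed.

Lemma ReCM a z : complex.Re (a%:C * z) = a * complex.Re z.
Proof. by case: z => x y /=; rewrite mul0r subr0. Qed.

Lemma ReJ z : complex.Re (Num.conj z) = complex.Re z.
Proof. by case: z. Qed.

Lemma conj_real_complex a : Num.conj (a%:C : R[i]) = a%:C.
Proof. exact: conjc_real. Qed.

Lemma Re_norm z : (complex.Re `|z|)%:C = `|z|.
Proof. by rewrite RRe_real ?normr_real. Qed.

Lemma Re_norm_ge0 z : 0 <= complex.Re `|z|.
Proof. by rewrite -lecR Re_norm normr_ge0. Qed.

End ComplexParts.

Section HilbertNorm.
Context {R : realType}.
Implicit Types H : hilbertType R.

Lemma hnormE H (x : H) : (hnorm x)%:C = `|x|.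
Proof. by rewrite /hnorm RRe_real ?normr_real. Qed.

Lemma hnorm_ge0 H (x : H) : 0 <= hnorm x.
Proof. by rewrite -lecR hnormE normr_ge0. Qed.

Lemma hnorm0 H : hnorm (0 : H) = 0.
Proof. by rewrite /hnorm normr0. Qed.

Lemma hnorm_gt0 H (x : H) : (0 < hnorm x) = (x != 0).
Proof. by rewrite -ltcR hnormE normr_gt0. Qed.

Lemma ler_hnormD H (x y : H) : hnorm (x + y) <= hnorm x + hnorm y.
Proof. by rewrite -lecR rmorphD/= !hnormE ler_normD. Qed.

Lemma hnorm_opp H (x : H) : hnorm (- x) = hnorm x.
Proof. by rewrite /hnorm normrN. Qed.

Lemma hnorm_distC H (x y : H) : hnorm (x - y) = hnorm (y - x).
Proof. by rewrite -hnorm_opp opprB. Qed.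

Lemma hnorm_distD H (y x z : H) : hnorm (x - z) <= hnorm (x - y) + hnorm (y - z).
Proof. by rewrite (le_trans _ (ler_hnormD _ _))// addrA subrK. Qed.

Lemma ler_dist_hnorm H (x y : H) : `|hnorm x - hnorm y| <= hnorm (x - y).
Proof.
have h (u v : H) : hnorm u - hnorm v <= hnorm (u - v).
  by rewrite lerBlDr (le_trans _ (ler_hnormD _ _))// subrK.
by rewrite ler_norml lerNl opprB hnorm_distC !h hnorm_distC h.
Qed.

Lemma hnormZ H (a : R[i]) (x : H) : hnorm (a *: x) = complex.Re `|a| * hnorm x.
Proof. by rewrite /hnorm normrZ -(Re_norm a) ReCM. Qed.

Lemma hnormZr H (a : R) (x : H) : hnorm (a%:C *: x) = `|a| * hnorm x.
Proof. by rewrite hnormZ normc_def/= expr0n/= addr0 sqrtr_sqr. Qed.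

Lemma hnorm_sum H I (s : seq I) (F : I -> H) :
  hnorm (\sum_(i <- s) F i) <= \sum_(i <- s) hnorm (F i).
Proof.
elim: s => [|i s IH]; first by rewrite !big_nil hnorm0.
by rewrite !big_cons (le_trans (ler_hnormD _ _))// lerD2l.
Qed.

Lemma innerDl H (x y z : H) : inner (x + y) z = inner x z + inner y z.
Proof. exact: linearDl. Qed.

Lemma innerDr H (x y z : H) : inner x (y + z) = inner x y + inner x z.
Proof. exact: linearDr. Qed.

Lemma innerZl H a (x y : H) : inner (a *: x) y = a * inner x y.
Proof. exact: linearZl_LR. Qed.

Lemma innerZr H a (x y : H) : inner x (a *: y) = Num.conj a * inner x y.
Proof. exact: linearZr_LR. Qed.

Lemma innerNl H (x y : H) : inner (- x) y = - inner x y.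
Proof. exact: linearNl. Qed.

Lemma innerNr H (x y : H) : inner x (- y) = - inner x y.
Proof. exact: linearNr. Qed.

Lemma innerC H (x y : H) : inner y x = Num.conj (inner x y).
Proof. by rewrite (hermC inner y x) expr0 mul1r. Qed.

Lemma innerxx H (x : H) : inner x x = (hnorm x ^+ 2)%:C.
Proof. by rewrite -sqr_normr_inner rmorphXn/= hnormE. Qed.

Lemma Re_innerC H (x y : H) : complex.Re (inner y x) = complex.Re (inner x y).
Proof. by rewrite innerC ReJ. Qed.

Lemma hnormB_sqr H (x y : H) :
  hnorm (x - y) ^+ 2 = hnorm x ^+ 2 - 2 * complex.Re (inner x y) + hnorm y ^+ 2.
Proof.
apply: complexI; rewrite -innerxx innerDl !innerDr !innerNl !innerNr.
rewrite (innerC x y); move: (inner x y) => z; rewrite !innerxx.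
case: z => u v; apply/eqP; rewrite eq_complex/=.
by apply/andP; split; apply/eqP => /=; ring.
Qed.

Lemma cauchy_schwarz H (x y : H) :
  `|complex.Re (inner x y)| <= hnorm x * hnorm y.
Proof.
rewrite -ler_sqr ?nnegrE ?mulr_ge0 ?hnorm_ge0// real_normK ?num_real//.
have [x0|x0] := eqVneq x 0.
  by rewrite x0 (linear0l inner) hnorm0 mul0r.
have p0 : 0 < hnorm x by rewrite hnorm_gt0.
set b := complex.Re _.
pose c := b / hnorm x ^+ 2.
have := hnormB_sqr y (c%:C *: x).
have -> : complex.Re (inner y (c%:C *: x)) = c * b.
  by rewrite innerC innerZl ReJ ReCM.
rewrite hnormZr exprMn real_normK ?num_real// => E.
have : 0 <= hnorm (y - c%:C *: x) ^+ 2 by rewrite sqr_ge0.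
rewrite E /c => h; rewrite exprMn mulrC -ler_pdivrMr ?exprn_gt0// -subr_ge0.
by apply: le_trans h _; rewrite le_eqVlt; apply/orP; left; apply/eqP; field; lra.
Qed.

Lemma linear_bounded H (H' : hilbertType R) (f : {linear H -> H'}) :
  continuous f -> exists2 K : R, 0 < K & forall x, hnorm (f x) <= K * hnorm x.
Proof.
move=> /linear_bounded_continuous/linear_boundedP/pinfty_ex_gt0[K K0 fK].
exists (complex.Re K).
  by move: K0; rewrite ltcE => /andP[_].
move=> x; have := fK x; have -> : K = (complex.Re K)%:C by rewrite RRe_real// gtr0_real.
by rewrite -!hnormE -rmorphM lecR.
Qed.

Lemma bounded_linear_cont H (H' : hilbertType R) (f : {linear H -> H'}) (K : R) :
  (forall x, hnorm (f x) <= K * hnorm x) -> continuous f.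
Proof.
move=> fK; apply/linear_bounded_continuous/linear_boundedP.
exists K%:C; split; first by rewrite complex_real.
move=> r Kr x; rewrite (le_trans (_ : _ <= K%:C * `|x|))//.
  by rewrite -!hnormE -rmorphM lecR.
by rewrite ler_wpM2r// ltW.
Qed.

Lemma complete_limit H (u : nat -> H) (e : nat -> R) :
  e n @[n --> \oo] --> 0 ->
  (forall n m, (n <= m)%N -> hnorm (u m - u n) <= e n) ->
  exists l, forall n, hnorm (l - u n) <= e n.
Proof.
move=> e0 ue.
have cu : cvg (u n @[n --> \oo]).
  apply: cauchy_cvg; apply: cauchy_exP => eps eps0.
  have Reps0 : 0 < complex.Re eps by move: eps0; rewrite ltcE => /andP[].
  have /cvgrPdist_lt/(_ _ Reps0)[N _ HN] := e0.
  exists (u N); exists N => //= m Nm.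
  rewrite -ball_normE/= -hnormE hnorm_distC.
  have -> : eps = (complex.Re eps)%:C by rewrite RRe_real// gtr0_real.
  rewrite ltcR (le_lt_trans (ue _ _ Nm))//.
  by have := HN N (leqnn N); rewrite /= sub0r normrN; apply: le_lt_trans; rewrite ler_norm.
exists (lim (u n @[n --> \oo])) => n; apply/ler_addgt0Pr => eps eps0.
have eps0' : 0 < eps%:C by rewrite ltcR.
have /cvgrPdist_lt/(_ _ eps0')[N _ HN] := cu.
have := HN (maxn N n) (leq_maxl _ _); rewrite /= -hnormE ltcR => h1.
rewrite (le_trans (hnorm_distD (u (maxn N n)) _ _))// addrC lerD//.
  by apply: ue; exact: leq_maxr.
exact: ltW.
Qed.

End HilbertNorm.

(** * Functional calculus of a positive operator *)

Section PolynomialCalculus.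
Context {R : realType} {H : hilbertType R} (A : {linear H -> H}).
Implicit Types (p q : {poly R[i]}) (x y : H).

Lemma poly_opE p N x : (size p <= N)%N ->
  poly_op A p x = \sum_(i < N) p`_i *: iter i A x.
Proof.
move=> pN; rewrite /poly_op (big_ord_widen N (fun i => p`_i *: iter i A x))//.
rewrite big_mkcond; apply: eq_bigr => i _.
by case: ltnP => // pi; rewrite nth_default// scale0r.
Qed.

Lemma poly_opD p q x : poly_op A (p + q) x = poly_op A p x + poly_op A q x.
Proof.
set N := maxn (size p) (size q).
rewrite (poly_opE _ (size_polyD p q)) !(@poly_opE _ N) ?leq_maxl ?leq_maxr//.
by rewrite -big_split/=; apply: eq_bigr => i _; rewrite coefD scalerDl.
Qed.

Lemma poly_opZ a p x : poly_op A (a *: p) x = a *: poly_op A p x.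
Proof.
rewrite (poly_opE _ (size_scale_leq a p)) /poly_op scaler_sumr.
by apply: eq_bigr => i _; rewrite coefZ scalerA.
Qed.

Lemma poly_opN p x : poly_op A (- p) x = - poly_op A p x.
Proof. by rewrite -scaleN1r poly_opZ scaleN1r. Qed.

Lemma poly_opB p q x : poly_op A (p - q) x = poly_op A p x - poly_op A q x.
Proof. by rewrite poly_opD poly_opN. Qed.

Lemma poly_opC a x : poly_op A a%:P x = a *: x.
Proof. by rewrite (poly_opE _ (size_polyC_leq1 a)) big_ord1 coefC. Qed.

Lemma poly_op1 x : poly_op A 1 x = x.
Proof. by rewrite -polyC1 poly_opC scale1r. Qed.

Lemma poly_op0 x : poly_op A 0 x = 0.
Proof. by rewrite -polyC0 poly_opC scale0r. Qed.

Lemma poly_opMX p x : poly_op A (p * 'X) x = A (poly_op A p x).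
Proof.
rewrite (@poly_opE _ (size p).+1); last first.
  by rewrite (leq_trans (size_polyMleq _ _))// size_polyX addn2.
rewrite big_ord_recl coefMX/= scale0r add0r /poly_op linear_sum.
by apply: eq_bigr => i _; rewrite /bump/= add1n coefMX/= linearZ.
Qed.

Lemma poly_opX x : poly_op A 'X x = A x.
Proof. by rewrite -['X]mul1r poly_opMX poly_op1. Qed.

Lemma poly_opXn n x : poly_op A 'X^n x = iter n A x.
Proof.
by elim: n => [|n IH]; rewrite ?poly_op1// exprSr poly_opMX IH.
Qed.

Lemma poly_op_linear p : linear (poly_op A p).
Proof.
elim/poly_ind: p => [|p c IH] a x y; first by rewrite !poly_op0 scaler0 addr0.
rewrite !poly_opD !poly_opMX !poly_opC IH linearP !scalerDr !scalerA mulrC.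
by rewrite addrACA.
Qed.

HB.instance Definition _ p :=
  GRing.isLinear.Build R[i] H H *:%R (poly_op A p) (poly_op_linear p).

Lemma poly_opM p q x : poly_op A (p * q) x = poly_op A p (poly_op A q x).
Proof.
elim/poly_ind: p x q => [|p c IH] x q; first by rewrite mul0r !poly_op0.
have pA z : poly_op A p (A z) = A (poly_op A p z).
  by rewrite -poly_opX -IH poly_opMX.
rewrite mulrDl -mulrA poly_opD mul_polyC poly_opZ IH ['X * q]mulrC poly_opMX.
by rewrite pA poly_opD poly_opMX poly_opC.
Qed.

Lemma poly_op_sum I (s : seq I) (F : I -> {poly R[i]}) x :
  poly_op A (\sum_(i <- s) F i) x = \sum_(i <- s) poly_op A (F i) x.
Proof.
elim: s => [|i s IH]; first by rewrite !big_nil poly_op0.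
by rewrite !big_cons poly_opD IH.
Qed.

Lemma poly_op_bounded p : continuous A ->
  exists2 K : R, 0 < K & forall x, hnorm (poly_op A p x) <= K * hnorm x.
Proof.
move=> /linear_bounded[K K0 AK]; elim/poly_ind: p => [|p c [L L0 IH]].
  by exists 1 => // x; rewrite poly_op0 hnorm0 mul1r hnorm_ge0.
exists (K * L + complex.Re `|c|).
  rewrite ltr_wpDr ?mulr_gt0//; exact: Re_norm_ge0.
move=> x; rewrite poly_opD poly_opMX poly_opC (le_trans (ler_hnormD _ _))//.
rewrite mulrDl hnormZ lerD2r -mulrA (le_trans (AK _))// ler_wpM2l// ltW//.
Qed.

Lemma outside_spectrum l : ~ spectrum A l ->
  exists2 K : R, 0 < K & forall x, hnorm x <= K * hnorm (poly_op A ('X - l%:P) x).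
Proof.
move=> /contrapT[B [cB BA _]]; have [K K0 BK] := linear_bounded cB.
by exists K => // x; rewrite poly_opB poly_opX poly_opC -{1}(BA x) BK.
Qed.

(** The negation says that [0] is an approximate eigenvalue of [p(A)]. Lower bounds multiply along a
    factorization of [p]. *)
Definition bounded_below p := exists2 K : R, 0 < K &
  forall x, hnorm x <= K * hnorm (poly_op A p x).

Lemma bounded_below_M p q :
  bounded_below p -> bounded_below q -> bounded_below (p * q).
Proof.
move=> [K K0 Kp] [L L0 Lq]; exists (L * K); first exact: mulr_gt0.
move=> x; rewrite poly_opM (le_trans (Lq x))// -mulrA ler_wpM2l// ltW//.
Qed.

(** Half of the spectral mapping theorem: [p] splits into linear factors, and if no root were in the
    spectrum, each factor, hence the product, would be bounded below. *)
Lemma not_bounded_below_root p : p != 0 -> ~ bounded_below p ->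
  exists2 l, spectrum A l & root p l.
Proof.
move=> p0; have [r pE] := closed_field_poly_normal p.
apply: contra_notP => H0.
have {}H0 z : z \in r -> bounded_below ('X - z%:P).
  move=> zr; apply: outside_spectrum => zA; apply: H0; exists z => //.
  by rewrite pE rootZ ?lead_coef_eq0// root_prod_XsubC.
have : bounded_below (\prod_(z <- r) ('X - z%:P)).
  elim: r H0 {pE} => [|z r IH] H0.
    by rewrite big_nil; exists 1 => // x; rewrite poly_op1 mul1r.
  rewrite big_cons; apply: bounded_below_M; first by apply: H0; exact: mem_head.
  by apply: IH => y yr; apply: H0; rewrite in_cons yr orbT.
set P := \prod_(_ <- _) _ in pE * => -[K K0 HK].
have lc0 : 0 < complex.Re `|lead_coef p|.
  by rewrite -ltcR Re_norm normr_gt0 lead_coef_eq0.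
exists (K / complex.Re `|lead_coef p|); first exact: divr_gt0.
move=> x; rewrite [in poly_op _ _ _]pE poly_opZ hnormZ mulrA divfK ?gt_eqF//.
Qed.

Section SelfAdjoint.
Hypothesis cA : continuous A.
Hypothesis adjA : forall x y, inner (A x) y = inner x (A y).

Lemma poly_op_adj p x y :
  inner (poly_op A p x) y = inner x (poly_op A (map_poly Num.conj p) y).
Proof.
elim/poly_ind: p x y => [|p c IH] x y.
  by rewrite rmorph0 !poly_op0 (linear0l inner) (linear0r inner).
rewrite rmorphD rmorphM/= map_polyX map_polyC/= !poly_opD !poly_opMX !poly_opC.
rewrite innerDl innerDr innerZl innerZr conjCK; congr (_ + _).
by rewrite adjA IH -!poly_opX -!poly_opM mulrC.
Qed.

(** Expand the form of [S] at [L x - S x], which is nonnegative, and bound its value at [S x] by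
    [L |S x|^2]. The lemma turns a small value of the form at [x] into a small [S x]. *)
Lemma symmetric_sqr_le (S : {linear H -> H}) (L : R) : 0 < L ->
  (forall x y, inner (S x) y = inner x (S y)) ->
  (forall x, 0 <= complex.Re (inner (S x) x)) ->
  (forall x, hnorm (S x) <= L * hnorm x) ->
  forall x, hnorm (S x) ^+ 2 <= L * complex.Re (inner (S x) x).
Proof.
move=> L0 adjS posS SL x.
have := posS (L%:C *: x - S x).
have -> : S (L%:C *: x - S x) = L%:C *: S x - S (S x) by rewrite linearB linearZ.
set y := S x; rewrite innerDl !innerDr !innerNl !innerNr !innerZl !innerZr.
rewrite !(ReD, ReN, ReCM) conj_real_complex !ReCM.
rewrite (adjS y x) -/y innerxx/=.
have h1 : complex.Re (inner (S y) y) <= L * hnorm y ^+ 2.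
  rewrite (le_trans (ler_norm _))// (le_trans (cauchy_schwarz _ _))//.
  by rewrite expr2 mulrA ler_wpM2r// hnorm_ge0.
set a := complex.Re (inner y x) => h2.
rewrite -subr_ge0 -(pmulr_rge0 _ L0); apply: le_trans h2 _.
by rewrite -subr_ge0; lra.
Qed.

(* The supremum [m] of the numerical range of [h(A)] is an approximate
   eigenvalue of [h(A)]. *)
Lemma numerical_range_sup (h : {poly R[i]}) : map_poly Num.conj h = h ->
  (exists x : H, x != 0) -> exists m : R,
    (forall x, complex.Re (inner (poly_op A h x) x) <= m * hnorm x ^+ 2) /\
    ~ bounded_below (m%:C%:P - h).
Proof.
move=> hh [x0 x00]; have [K K0 hK] := poly_op_bounded h cA.
pose E := [set complex.Re (inner (poly_op A h x) x) | x in [set x | hnorm x = 1]].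
have n0 : 0 < hnorm x0 by rewrite hnorm_gt0.
have normalize x : x != 0 -> hnorm ((hnorm x)^-1%:C *: x) = 1.
  rewrite -hnorm_gt0 => x1.
  by rewrite hnormZr gtr0_norm ?invr_gt0// mulVf// gt_eqF.
have supE : has_sup E.
  split; first by eexists; exists ((hnorm x0)^-1%:C *: x0) => //=; exact: normalize.
  exists K => _ [x /= x1 <-].
  rewrite (le_trans (ler_norm _))// (le_trans (cauchy_schwarz _ _))//.
  by rewrite x1 mulr1 (le_trans (hK _))// x1 mulr1.
have le_sup x : complex.Re (inner (poly_op A h x) x) <= sup E * hnorm x ^+ 2.
  have [->|x1] := eqVneq x 0.
    by rewrite (linear0r inner) hnorm0 expr0n mulr0.
  have n1 : 0 < hnorm x by rewrite hnorm_gt0.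
  have -> : x = (hnorm x)%:C *: ((hnorm x)^-1%:C *: x).
    by rewrite scalerA -rmorphM mulfV ?gt_eqF// scale1r.
  move: (normalize _ x1); set y := _ *: x => y1.
  have -> : poly_op A h ((hnorm x)%:C *: y) = (hnorm x)%:C *: poly_op A h y.
    by rewrite linearZ.
  rewrite innerZl innerZr conj_real_complex !ReCM hnormZr y1 mulr1.
  rewrite gtr0_norm// mulrA -expr2 mulrC ler_wpM2r ?sqr_ge0//.
  by apply: sup_upper_bound => //; exists y.
exists (sup E); split => // -[L L0 hL].
set m := sup E in le_sup hL.
have [N N0 hN] := poly_op_bounded (m%:C%:P - h) cA.
have SE x : complex.Re (inner (poly_op A (m%:C%:P - h) x) x) =
    m * hnorm x ^+ 2 - complex.Re (inner (poly_op A h x) x).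
  by rewrite poly_opB poly_opC innerDl innerNl innerZl ReD ReN ReCM innerxx.
have S2 : forall x, hnorm (poly_op A (m%:C%:P - h) x) ^+ 2 <=
    N * complex.Re (inner (poly_op A (m%:C%:P - h) x) x).
  apply: symmetric_sqr_le => //.
    move=> x y; rewrite poly_op_adj rmorphB/= hh map_polyC/=.
    by rewrite conj_real_complex.
  by move=> x; rewrite SE subr_ge0.
(* If [m - h(A)] is bounded below by [1 / L], then [S2] keeps the form of [h(A)] at unit vectors at
   least this far below its supremum. *)
have d0 : 0 < (L ^+ 2 * N)^-1 by rewrite invr_gt0 mulr_gt0// exprn_gt0.
have [_ [x /= x1 <-]] := sup_adherent d0 supE.
apply/negP; rewrite -leNgt -/m lerBrDr -lerBrDl.
have := S2 x; rewrite SE x1 expr1n mulr1 => h1.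
have h2 : 1 <= L ^+ 2 * hnorm (poly_op A (m%:C%:P - h) x) ^+ 2.
  by rewrite -exprMn -(expr1n _ 2) ler_sqr ?nnegrE ?mulr_ge0 ?hnorm_ge0// ?(ltW L0)// -x1 hL.
rewrite -[X in X <= _]mul1r ler_pdivrMr ?mulr_gt0 ?exprn_gt0//.
by rewrite (le_trans h2)// [leRHS]mulrC -[leRHS]mulrA ler_wpM2l// exprn_ge0// ltW.
Qed.

(** Covers the case of [spectrum_bound] in which [m - h] is the zero polynomial and
    [not_bounded_below_root] does not apply; the polynomial [m - X] is never zero. *)
Lemma spectrum_nonempty : (exists x : H, x != 0) -> exists l, spectrum A l.
Proof.
move=> H0; have [|m [_ hm]] := numerical_range_sup _ H0 (h := 'X).
  by rewrite map_polyX.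
have [|l Al _] := not_bounded_below_root _ hm; last by exists l.
by rewrite -oppr_eq0 opprB polyXsubC_eq0.
Qed.

(* For [h := p^* p], the supremum of the numerical range of [h(A)] is [h l] for
   some [l] in the spectrum of [A], namely a root of [m - h]. *)
Lemma spectrum_bound p (M : R) : 0 <= M ->
  (forall l, spectrum A l -> 0 <= l) ->
  (forall l, spectrum A l -> `|p.[l]| <= M%:C) ->
  forall x, hnorm (poly_op A p x) <= M * hnorm x.
Proof.
move=> M0 Apos pM x.
have [->|x0] := eqVneq x 0; first by rewrite linear0 hnorm0 mulr0.
have H0 : exists x : H, x != 0 by exists x.
pose h := map_poly Num.conj p * p.
have hh : map_poly Num.conj h = h.
  rewrite rmorphM/= -map_poly_comp mulrC; congr (_ * _).
  by apply: map_poly_id => z _ /=; rewrite conjCK.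
have [m [hm nb]] := numerical_range_sup hh H0.
have [l Al] : exists2 l, spectrum A l & root (m%:C%:P - h) l.
  have [g0|g0] := eqVneq (m%:C%:P - h) 0; last exact: not_bounded_below_root.
  by have [l Al] := spectrum_nonempty H0; exists l => //; rewrite g0 root0.
rewrite /root !hornerE subr_eq0 => /eqP ml.
(* At a real point the polynomial with conjugate coefficients takes the conjugate value, so [h] is
   [|p l|^2] there. *)
have lr : Num.conj l = l by rewrite geC0_conj// Apos.
have {}ml : m%:C = `|p.[l]| ^+ 2.
  by rewrite ml mulrC -{2}lr horner_map/= normCK.
have mM : m <= M ^+ 2.
  have MC : 0 <= M%:C by rewrite ler0c.
  by rewrite -lecR ml rmorphXn/= lerXn2r ?nnegrE ?normr_ge0//; exact: pM.
rewrite -ler_sqr ?nnegrE ?mulr_ge0 ?hnorm_ge0// exprMn.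
rewrite (le_trans _ (ler_wpM2r (sqr_ge0 _) mM))//.
apply: le_trans (hm x).
by rewrite /h poly_opM Re_innerC -poly_op_adj innerxx.
Qed.

End SelfAdjoint.

End PolynomialCalculus.

(** * Inverses of coercive operators *)

Section CoerciveOperators.
Context {R : realType} {H : hilbertType R}.

(* Lax-Milgram: [f x = y] is solved by the Neumann series of
   [S := 1 - rho w f], which is a strict contraction for small [rho]. *)
Lemma coercive_inverse (f : {linear H -> H}) (w : R[i]) (c : R) :
  continuous f -> 0 < c -> `|w| = 1 ->
  (forall x, c * hnorm x ^+ 2 <= complex.Re (w * inner (f x) x)) ->
  exists B : {linear H -> H},
    [/\ continuous B, forall x, B (f x) = x & forall x, f (B x) = x].
Proof.
move=> cf c0 w1 coer; have [K0 K00 fK0] := linear_bounded cf.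
(* The maximum ensures [c <= K], hence [q2 >= 0] below, also when [H] is zero. *)
pose K := Num.max K0 c.
have K0' : 0 < K by rewrite lt_max K00.
have fK x : hnorm (f x) <= K * hnorm x.
  by rewrite (le_trans (fK0 x))// ler_wpM2r ?hnorm_ge0// le_max lexx.
have cK : c <= K by rewrite le_max lexx orbT.
have fwn x : hnorm (w *: x) = hnorm x by rewrite hnormZ w1 mul1r.
have below x : c * hnorm x <= hnorm (f x).
  have [->|x0] := eqVneq x 0; first by rewrite hnorm0 mulr0 hnorm_ge0.
  rewrite -(ler_pM2r (_ : 0 < hnorm x)) ?hnorm_gt0//.
  rewrite -mulrA -expr2 (le_trans (coer x))// -innerZl.
  by rewrite (le_trans (ler_norm _))// (le_trans (cauchy_schwarz _ _))// fwn.
have fI : injective f.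
  move=> x y fxy; apply/eqP; rewrite -subr_eq0 -[_ == _]negbK -hnorm_gt0 -leNgt.
  have := below (x - y); rewrite linearB fxy subrr hnorm0.
  by rewrite pmulr_rle0.
(* This value minimizes [1 - 2 rho c + rho^2 K^2], the bound for the squared norm of [S]; the
   minimum is [q2]. *)
pose rho := c / K ^+ 2.
have rho0 : 0 < rho by rewrite divr_gt0 ?exprn_gt0.
pose q2 := 1 - (c / K) ^+ 2.
have q21 : q2 < 1 by rewrite ltrBlDr ltrDl exprn_gt0// divr_gt0.
have q20 : 0 <= q2.
  by rewrite subr_ge0 -(expr1n _ 2) ler_sqr ?nnegrE ?divr_ge0 ?(ltW c0) ?(ltW K0')// ler_pdivrMr// mul1r.
pose q := Num.sqrt q2.
have q0 : 0 <= q by exact: sqrtr_ge0.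
have q1 : q < 1 by rewrite -sqrtr1 ltr_sqrt.
pose S : H -> H := fun x => x - rho%:C *: (w *: f x).
have Sq x : hnorm (S x) <= q * hnorm x.
  rewrite -ler_sqr ?nnegrE ?mulr_ge0 ?hnorm_ge0// exprMn sqr_sqrtr//.
  rewrite hnormB_sqr hnormZr fwn gtr0_norm//.
  rewrite Re_innerC innerZl ReCM innerZl.
  have h1 := coer x.
  have h2 : hnorm (f x) ^+ 2 <= (K * hnorm x) ^+ 2.
    by rewrite ler_sqr ?nnegrE ?mulr_ge0 ?hnorm_ge0 ?(ltW K0').
  set a := complex.Re _ in h1 *; set F := hnorm (f x) in h2 *.
  set X := hnorm x in h1 h2 *.
  have h3 : rho * (c * X ^+ 2) <= rho * a by rewrite ler_pM2l.
  have h4 : rho ^+ 2 * F ^+ 2 <= rho ^+ 2 * (K * X) ^+ 2.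
    by rewrite ler_wpM2l// sqr_ge0.
  have -> : q2 * X ^+ 2 = X ^+ 2 - 2 * (rho * (c * X ^+ 2)) + rho ^+ 2 * (K * X) ^+ 2.
    by rewrite /q2 /rho; field; rewrite gt_eqF.
  by rewrite exprMn; lra.
have Sn n x : hnorm (iter n S x) <= q ^+ n * hnorm x.
  elim: n => [|n IH]; first by rewrite mul1r.
  by rewrite iterS (le_trans (Sq _))// exprS -mulrA ler_wpM2l.
have qn0 (a : R) : a * q ^+ n @[n --> \oo] --> 0.
  rewrite -[X in _ --> X](mulr0 a); apply: cvgMr.
  by apply: cvg_expr; rewrite ger0_norm.
have surj y : exists x, f x = y.
  pose u n := \sum_(k < n) iter k S (rho%:C *: (w *: y)).
  (* Since [rho w f = 1 - S], the image of the partial sum telescopes and the residual is a single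
     iterate of [S]. *)
  have fu n : rho%:C *: (w *: (f (u n) - y)) = - iter n S (rho%:C *: (w *: y)).
    elim: n => [|n IH]; first by rewrite /u big_ord0 linear0 sub0r !scalerN.
    rewrite /u big_ord_recr/= -/(u n); set t := iter n S _ in IH *.
    rewrite [f (_ + _)]linearD addrAC [w *: (_ + f _)]scalerDr.
    by rewrite [rho%:C *: (_ + _ *: f _)]scalerDr IH /S opprB addrC.
  set z := rho%:C *: (w *: y) in u fu.
  have unm n m : (n <= m)%N -> hnorm (u m - u n) <= hnorm z / (1 - q) * q ^+ n.
    move=> nm; rewrite -(subnKC nm); move: (m - n)%N {nm} => k.
    have C0 : 0 <= hnorm z / (1 - q) by rewrite divr_ge0 ?hnorm_ge0// subr_ge0 ltW.
    (* The subtracted term makes the geometric bound pass through the induction on [k]. *)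
    apply: (@le_trans _ _ (hnorm z / (1 - q) * (q ^+ n - q ^+ (n + k)))); last first.
      by rewrite ler_wpM2l// lerBlDr lerDl exprn_ge0.
    elim: k => [|k IH]; first by rewrite addn0 !subrr hnorm0 mulr0.
    rewrite addnS /u big_ord_recr/= -/(u (n + k)%N) addrAC.
    rewrite (le_trans (ler_hnormD _ _))//.
    apply: le_trans (lerD IH (Sn _ _)) _; rewrite le_eqVlt; apply/orP; left.
    by apply/eqP; rewrite exprS; field; rewrite subr_eq0 gt_eqF.
  have [x xu] := complete_limit (qn0 _) unm.
  exists x; apply/eqP; rewrite -subr_eq0 -[_ == _]negbK -hnorm_gt0 -leNgt.
  have bnd n : hnorm (f x - y) <= (K * (hnorm z / (1 - q)) + hnorm z / rho) * q ^+ n.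
    rewrite (le_trans (hnorm_distD (f (u n)) _ _))// mulrDl lerD//.
      by rewrite -linearB (le_trans (fK _))// -mulrA ler_wpM2l ?(ltW K0').
    have := congr1 (@hnorm _ H) (fu n).
    rewrite hnormZr fwn hnorm_opp gtr0_norm// => E.
    by rewrite mulrAC ler_pdivlMr// mulrC E mulrC Sn.
  apply: (ler_cvg_to (cvg_cst _) (qn0 _)).
  by apply: nearW => n; exact: bnd.
have [B fB] := choice surj.
have Blin : linear B by move=> a x y; apply: fI; rewrite fB linearP !fB.
pose Bl : {linear H -> H} := HB.pack B (GRing.isLinear.Build _ _ _ _ _ Blin).
exists Bl; split => //.
  apply: (@bounded_linear_cont _ _ _ _ c^-1) => x.
  by rewrite -[in leRHS](fB x) ler_pdivlMl.
by move=> x; apply: fI; rewrite fB.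
Qed.

End CoerciveOperators.

(** * Self-adjointness and spectrum of a positive operator *)

Section PositiveOperators.
Context {R : realType} {H : hilbertType R} (A : {linear H -> H}).
Hypothesis posA : positive_operator A.

Let posAr (x : H) : 0 <= complex.Re (inner (A x) x).
Proof. by have := posA.2 x; rewrite lecE => /andP[]. Qed.

Let imA (x : H) : complex.Im (inner (A x) x) = 0.
Proof. by apply: ger0_Im; exact: posA.2. Qed.

(** Polarization: the quadratic form is real at [x], [y], [x + y] and [x + i y]. *)
Lemma positive_adj (x y : H) : inner (A x) y = inner x (A y).
Proof.
rewrite (innerC (A y) x).
have h1 := imA (x + y); have h2 := imA (x + 'i *: y).
have AD u v : A (u + v) = A u + A v by rewrite linearD.
have AZ u : A ('i *: u) = 'i *: A u by rewrite linearZ.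
move: h1 h2; rewrite !AD AZ !innerDl !innerDr !innerZl !innerZr.
have := imA x; have := imA y.
case: (inner (A x) x) => a1 a2 /=; case: (inner (A y) y) => b1 b2 /=.
case: (inner (A x) y) => c1 c2 /=; case: (inner (A y) x) => d1 d2 /=.
move=> ? ? h1 h2; apply/eqP; rewrite eq_complex/=.
by apply/andP; split; apply/eqP; lra.
Qed.

Lemma positive_spectrum (M : R) : (forall x, complex.Re (inner (A x) x) <= M * hnorm x ^+ 2) ->
  forall l, spectrum A l -> 0 <= l /\ complex.Re l <= M.
Proof.
move=> AM l; apply: contra_notP => lM.
have Ax x : inner (A x) x = (complex.Re (inner (A x) x))%:C.
  by rewrite RRe_real// ger0_real// posA.2.
(* Here [s] stands for the form at [x] and [n] for [|x|^2]. A point [l] outside the segment [[0, M]]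
   is separated from it by a line, and [w] rotates the segment minus [l] into a half-plane
   [Re >= c]; then [A - l] is coercive. *)
have [w [c [c0 w1 cw]]] : exists (w : R[i]) (c : R), [/\ 0 < c, `|w| = 1 &
    forall s : R, forall n : R, 0 <= s -> s <= M * n -> 0 <= n ->
      c * n <= complex.Re (w * (s%:C - l * n%:C))].
  case: l lM => u v lM.
  have [v0|v0|v0] := ltgtP v 0.
  - exists (- 'i), (- v); split => //; first by rewrite oppr_gt0.
      by rewrite normrN normc_def/= expr0n/= expr1n add0r sqrtr1.
    by move=> s n s0 sM n0 /=; lra.
  - exists 'i, v; split => //.
      by rewrite normc_def/= expr0n/= expr1n add0r sqrtr1.
    by move=> s n s0 sM n0 /=; lra.
  - subst v; have [u0|u0] := ltP u 0.
      exists 1, (- u); split; rewrite ?oppr_gt0// ?normr1//.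
      by move=> s n s0 sM n0 /=; lra.
    have [uM|uM] := ltP M u.
      exists (- 1), (u - M); split; rewrite ?subr_gt0// ?normrN1//.
      by move=> s n s0 sM n0 /=; lra.
    by exfalso; apply: lM; split => //; rewrite lecE/= eqxx.
have [||B [cB BA AB]] := @coercive_inverse _ _ (A \- l \*: idfun) w c _ c0 w1.
- have [K K0 AK] := linear_bounded posA.1.
  apply: (@bounded_linear_cont _ _ _ _ (K + complex.Re `|l|)) => x /=.
  by rewrite mulrDl (le_trans (ler_hnormD _ _))// hnorm_opp hnormZ lerD2r.
- move=> x /=; rewrite innerDl innerNl innerZl innerxx Ax.
  by apply: cw => //; rewrite sqr_ge0.
by exists B; split.
Qed.

End PositiveOperators.

Lemma ler_vanishing {R : realType} (X eta c n : R) : 0 <= n -> 0 <= c ->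
  (forall e, 0 < e -> X <= (eta + c * e) * n) -> X <= eta * n.
Proof.
move=> n0 c0 Xe; apply/ler_addgt0Pr => eps eps0.
have d0 : 0 < c * n + 1 by rewrite ltr_wpDl// mulr_ge0.
rewrite (le_trans (Xe (eps / (c * n + 1)) _)) ?divr_gt0// mulrDl lerD2l.
have -> : c * (eps / (c * n + 1)) * n = eps * (c * n / (c * n + 1)).
  by field; rewrite gt_eqF.
by rewrite ler_piMr ?(ltW eps0)// ler_pdivrMr// mul1r lerDl.
Qed.

(** * Real powers of a positive contraction *)

Section ContinuousCalculus.
Context {R : realType} {H : hilbertType R} (A : {linear H -> H}).
Hypothesis posA : positive_operator A.

Let cA : continuous A := posA.1.

Lemma positive_spectrum_ge0 l : spectrum A l -> 0 <= l.
Proof.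
have [K K0 AK] := linear_bounded cA.
move=> Al; have [|] := positive_spectrum posA (M := K) _ Al => // x.
rewrite (le_trans (ler_norm _))// (le_trans (cauchy_schwarz _ _))//.
by rewrite expr2 mulrA ler_wpM2r// hnorm_ge0.
Qed.

(** On the spectrum [q - p n] is at most [eta + e] for large [n], and [p n (A)] tends to [B]. Every
    estimate on the operator chosen by [cfc] goes through this lemma; [eta = 0] identifies it
    exactly. *)
Lemma is_cfc_approx f B (q : {poly R[i]}) (eta : R) : 0 <= eta ->
  is_cfc A f B -> (forall l, spectrum A l -> `|q.[l] - f l| <= eta%:C) ->
  forall x, hnorm (poly_op A q x - B x) <= eta * hnorm x.
Proof.
move=> eta0 [p [pf pB]] qf x.
suff bnd (e : R) : 0 < e -> hnorm (poly_op A q x - B x) <= (eta + 2 * e) * hnorm x.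
  by apply: (@ler_vanishing _ _ eta 2) => //; exact: hnorm_ge0.
move=> e0; have := filterI (pf e e0) (pB e e0).
case=> N _ /(_ N (leqnn N))[pfN pBN].
rewrite (le_trans (hnorm_distD (poly_op A (p N) x) _ _))//.
have -> : (eta + 2 * e) * hnorm x = (eta + e) * hnorm x + e * hnorm x by ring.
rewrite lerD// -poly_opB.
apply: (spectrum_bound cA (positive_adj posA)) => //.
- by rewrite addr_ge0// ltW.
- exact: positive_spectrum_ge0.
- move=> l Al; rewrite hornerD hornerN rmorphD/=.
  rewrite (le_trans (ler_distD (f l) _ _))// lerD ?qf//.
  by rewrite distrC pfN.
Qed.

Lemma cfcP f : (exists B, is_cfc A f B) -> is_cfc A f (cfc A f).
Proof. by move=> [B AB]; rewrite /cfc; apply: (@xgetPex _ (fun=> 0) [set B | is_cfc A f B]); exists B. Qed.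

Lemma op_power_nat n x : op_power A n%:R x = iter n A x.
Proof.
rewrite /op_power pnatr_eq0; case: eqP => [->//|n0].
have nX l : spectrum A l -> `|('X^n).[l] - (complex.Re l `^ n%:R)%:C| <= (0 : R)%:C.
  move=> /positive_spectrum_ge0 l0.
  have {1}-> : l = (complex.Re l)%:C by rewrite RRe_real// ger0_real.
  rewrite powR_mulrn; last by move: l0; rewrite lecE => /andP[].
  by rewrite hornerXn rmorphXn subrr normr0.
have cX : is_cfc A (fun z => (complex.Re z `^ n%:R)%:C) (fun x => iter n A x).
  exists (fun=> 'X^n); split => e e0; apply: nearW => _.
    by move=> l Al; rewrite (le_trans (nX _ Al))// lecR ltW.
  by move=> y; rewrite poly_opXn subrr hnorm0 mulr_ge0 ?hnorm_ge0// ltW.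
have := is_cfc_approx (lexx _) (cfcP (ex_intro _ _ cX)) nX x.
rewrite mul0r poly_opXn => h; apply/esym/eqP; rewrite -subr_eq0 -[_ == _]negbK.
by rewrite -hnorm_gt0 -leNgt.
Qed.

Definition rpoly_op (q : {poly R}) x := poly_op A (map_poly (real_complex R) q) x.

Lemma rpoly_opN q x : rpoly_op (- q) x = - rpoly_op q x.
Proof. by rewrite /rpoly_op rmorphN poly_opN. Qed.

Lemma rpoly_opB p q x : rpoly_op (p - q) x = rpoly_op p x - rpoly_op q x.
Proof. by rewrite /rpoly_op rmorphB poly_opB. Qed.

Lemma rpoly_opZ a q x : rpoly_op (a *: q) x = a%:C *: rpoly_op q x.
Proof. by rewrite /rpoly_op map_polyZ poly_opZ. Qed.

Lemma rpoly_op_sum I (s : seq I) (F : I -> {poly R}) x :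
  rpoly_op (\sum_(i <- s) F i) x = \sum_(i <- s) rpoly_op (F i) x.
Proof. by rewrite /rpoly_op rmorph_sum poly_op_sum. Qed.

Lemma rpoly_opM p q x : rpoly_op (p * q) x = rpoly_op p (rpoly_op q x).
Proof. by rewrite /rpoly_op rmorphM poly_opM. Qed.

Lemma rpoly_op1 x : rpoly_op 1 x = x.
Proof. by rewrite /rpoly_op rmorph1 poly_op1. Qed.

Lemma rpoly_opXn n x : rpoly_op 'X^n x = iter n A x.
Proof. by rewrite /rpoly_op map_polyXn poly_opXn. Qed.

Hypothesis contrA : forall x, hnorm (A x) <= hnorm x.

Lemma spectrum_itv l : spectrum A l ->
  exists2 a : R, 0 <= a <= 1 & l = a%:C.
Proof.
move=> Al; have [|l0 l1] := positive_spectrum posA (M := 1) _ Al.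
  move=> x; rewrite (le_trans (ler_norm _))// (le_trans (cauchy_schwarz _ _))//.
  by rewrite mul1r expr2 ler_wpM2r// hnorm_ge0.
exists (complex.Re l); last by rewrite RRe_real// ger0_real.
by rewrite l1 andbT; move: l0; rewrite lecE => /andP[].
Qed.

Lemma norm_real_complex (a : R) : `|a%:C| = `|a|%:C.
Proof. by rewrite normc_def/= expr0n/= addr0 sqrtr_sqr. Qed.

Lemma rpoly_bound q (M : R) : (forall x, 0 <= x <= 1 -> `|q.[x]| <= M) ->
  forall x, hnorm (rpoly_op q x) <= M * hnorm x.
Proof.
move=> qM; apply: (spectrum_bound cA (positive_adj posA)).
- by rewrite (le_trans _ (qM 0 _))// lexx ler01.
- exact: positive_spectrum_ge0.
- by move=> l /spectrum_itv[a a01 ->]; rewrite horner_map/= norm_real_complex lecR qM.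
Qed.

Lemma is_cfc_power t : 0 < t ->
  exists B, is_cfc A (fun z => (complex.Re z `^ t)%:C) B.
Proof.
(* [N > t] puts [s] in []0, 1]], where the binomial approximation is uniform on [[0, 1]]. *)
move=> t0; pose N := (Num.truncn t).+1; pose s := t / N%:R.
have N0 : 0 < N%:R :> R by rewrite ltr0n.
have s01 : 0 < s <= 1.
  rewrite divr_gt0//= ler_pdivrMr// mul1r ltW//.
  by rewrite truncnS_gt.
have s01' : 0 <= s <= 1 by case/andP: s01 => /ltW -> ->.
have Ns : N%:R * s = t by rewrite mulrC divfK// gt_eqF.
have pows K x : 0 <= x <= 1 -> `|(powp N s K).[x] - x `^ t| <= binprod s K.
  by move=> x01; rewrite -Ns; exact: powp_powR.
have cau x n m : (n <= m)%N ->
    hnorm (rpoly_op (powp N s m) x - rpoly_op (powp N s n) x) <=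
    2 * hnorm x * binprod s n.
  move=> nm; rewrite -rpoly_opB mulrAC; apply: rpoly_bound => y y01.
  rewrite hornerD hornerN (le_trans (ler_distD (y `^ t) _ _))//.
  rewrite mulrDl mul1r lerD//; last by rewrite distrC pows.
  by rewrite (le_trans (pows _ _ y01))// binprod_le.
have lim0 a : a * binprod s n @[n --> \oo] --> 0.
  by rewrite -[X in _ --> X](mulr0 a); apply: cvgMr; exact: binprod_cvg0.
have [B HB] := choice (fun x => complete_limit (lim0 (2 * hnorm x)) (@cau x)).
exists B; exists (fun n => map_poly (real_complex R) (powp N s n)); split => e e0.
  have /cvgrPdist_le/(_ _ e0) := binprod_cvg0 s01.
  apply: filterS => n; rewrite sub0r normrN => ne l /spectrum_itv[a a01 ->].
  rewrite horner_map/= -rmorphB norm_real_complex lecR (le_trans (pows _ _ a01))//.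
  by rewrite (le_trans (ler_norm _)).
have e2 : 0 < e / 2 by rewrite divr_gt0.
have /cvgrPdist_le/(_ _ e2) := binprod_cvg0 s01.
apply: filterS => n; rewrite sub0r normrN => ne x.
rewrite hnorm_distC (le_trans (HB x n))// mulrAC ler_wpM2r ?hnorm_ge0//.
by rewrite mulrC -ler_pdivlMr// (le_trans (ler_norm _)).
Qed.

Lemma rpoly_power t q (eta : R) : 0 <= t ->
  (forall x, 0 <= x <= 1 -> `|q.[x] - x `^ t| <= eta) ->
  forall x, hnorm (rpoly_op q x - op_power A t x) <= eta * hnorm x.
Proof.
move=> t0 qt x; rewrite /op_power; case: eqP => [t00|/eqP t00].
  rewrite -[X in _ - X]rpoly_op1 -rpoly_opB; apply: rpoly_bound => y y01.
  by have := qt y y01; rewrite t00 powRr0 !hornerE.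
have {}t0 : 0 < t by rewrite lt_neqAle eq_sym t00.
apply: is_cfc_approx (cfcP (is_cfc_power t0)) _ x.
  by rewrite (le_trans _ (qt 0 _))// lexx ler01.
move=> l /spectrum_itv[a a01 ->].
by rewrite horner_map/= -rmorphB norm_real_complex lecR qt.
Qed.

Lemma powR_approx t (e : R) : 0 <= t -> 0 < e ->
  exists q : {poly R}, forall x, 0 <= x <= 1 -> `|q.[x] - x `^ t| <= e.
Proof.
move=> t0 e0; have [t00|t00] := eqVneq t 0.
  by exists 1 => x _; rewrite t00 powRr0 hornerC subrr normr0 ltW.
pose N := (Num.truncn t).+1; pose s := t / N%:R.
have N0 : 0 < N%:R :> R by rewrite ltr0n.
have s01 : 0 < s <= 1.
  rewrite divr_gt0//= ?lt_neqAle ?t0 1?eq_sym ?t00//.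
  by rewrite ler_pdivrMr// mul1r ltW// truncnS_gt.
have /cvgrPdist_le/(_ _ e0)[K _ /(_ K (leqnn K))] := binprod_cvg0 s01.
rewrite /= sub0r normrN => Ke; exists (powp N s K) => x x01.
have -> : t = N%:R * s by rewrite mulrC divfK// gt_eqF.
rewrite (le_trans (powp_powR _ _ s01 x01))// (le_trans _ Ke)// ler_norm//.
Qed.

(** Carries a scalar Muntz estimate over to operators. Each power is replaced by a polynomial within
    [e]; this costs [S * e] in the scalar estimate and again for the operators, and [e] is
    arbitrary. *)
Lemma rpoly_power_sum (ts : seq R) (a : R -> R) q (eta : R) :
  (forall t, t \in ts -> 0 <= t) ->
  (forall x, 0 <= x <= 1 -> `|q.[x] - \sum_(t <- ts) a t * x `^ t| <= eta) ->
  forall x, hnorm (rpoly_op q x - \sum_(t <- ts) (a t)%:C *: op_power A t x)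
            <= eta * hnorm x.
Proof.
move=> ts0 qa x; set S := \sum_(t <- ts) `|a t|.
have S0 : 0 <= S by apply: sumr_ge0.
apply: (@ler_vanishing _ _ _ (2 * S)); rewrite ?hnorm_ge0 ?mulr_ge0// => e e0.
have [Q HQ] : exists Q : R -> {poly R}, forall t, t \in ts ->
    forall x, 0 <= x <= 1 -> `|(Q t).[x] - x `^ t| <= e.
  have /choice[Q HQ] : forall t : R, exists q : {poly R}, t \in ts ->
      forall x, 0 <= x <= 1 -> `|q.[x] - x `^ t| <= e.
    move=> t; have [/ts0 t0|] := boolP (t \in ts); last by exists 0.
    by have [p hp] := powR_approx t0 e0; exists p.
  by exists Q.
pose P := \sum_(t <- ts) a t *: Q t.
have -> : (eta + 2 * S * e) * hnorm x = (eta + S * e) * hnorm x + S * e * hnorm x.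
  by ring.
rewrite (le_trans (hnorm_distD (rpoly_op P x) _ _))// lerD//.
  rewrite -rpoly_opB; apply: rpoly_bound => y y01; rewrite hornerD hornerN.
  rewrite (le_trans (ler_distD (\sum_(t <- ts) a t * y `^ t) _ _))// lerD ?qa//.
  rewrite /P horner_sum -sumrB (le_trans (ler_norm_sum _ _ _))//.
  rewrite /S mulr_suml big_seq [leRHS]big_seq ler_sum// => t tts.
  by rewrite hornerZ -mulrBr normrM ler_wpM2l// distrC HQ.
rewrite /P rpoly_op_sum -sumrB (le_trans (hnorm_sum _ _))// /S !mulr_suml.
rewrite big_seq [leRHS]big_seq ler_sum// => t tts.
rewrite rpoly_opZ -scalerBr hnormZr -mulrA ler_wpM2l//.
by apply: rpoly_power; [exact: ts0|exact: HQ].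
Qed.

Lemma op_power_le t x : 0 <= t -> hnorm (op_power A t x) <= hnorm x.
Proof.
(* The zero polynomial approximates [x^t] on [[0, 1]] with error [1]. *)
move=> t0; have := @rpoly_power_sum [:: t] (fun=> 1) 0 1 _ _ x.
rewrite /rpoly_op rmorph0 poly_op0 big_seq1 scale1r sub0r hnorm_opp mul1r; apply.
  by move=> s; rewrite inE => /eqP ->.
move=> y /andP[y0 y1]; rewrite big_seq1 horner0 mul1r sub0r normrN ger0_norm ?powR_ge0//.
by have := @ge0_ler_powR R t t0 y 1; rewrite !nnegrE powR1; exact.
Qed.

End ContinuousCalculus.

(** * Perturbation of the observation times *)

Section FiniteSums.
Context {R : realType}.

(** Serves for pairing times with integers, where one time may be matched to several integers or
    conversely. *)
Lemma sum_multiplicity (I : Type) (J : eqType) (s : seq I) (f : I -> J)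
    (h : J -> R) (m : nat) : (forall j, 0 <= h j) ->
  (forall j, (count_mem j (map f s) <= m)%N) ->
  \sum_(i <- s) h (f i) <= m%:R * \sum_(j <- undup (map f s)) h j.
Proof.
move=> h0 sm; rewrite -(big_map f xpredT h) -big_undup_iterop_count/= mulr_sumr.
apply: ler_sum => j _; rewrite -[iterop _ _ _ _]/(h j *+ _).
by rewrite -[h j *+ _]mulr_natl ler_wpM2r// ler_nat.
Qed.

Lemma ler_sum_uniq_sub (J : eqType) (s t : seq J) (h : J -> R) :
  (forall j, 0 <= h j) -> uniq s -> {subset s <= t} ->
  \sum_(j <- s) h j <= \sum_(j <- t) h j.
Proof.
move=> h0; elim: s t => [|j s IH] t /=.
  by move=> _ _; rewrite big_nil sumr_ge0.
move=> /andP[js us] st.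
have jt : j \in t by apply: st; rewrite mem_head.
rewrite (perm_big _ (perm_to_rem jt)) !big_cons lerD2l; apply: IH => // k ks.
have := st k; rewrite in_cons ks orbT => /(_ isT).
rewrite (perm_mem (perm_to_rem jt)) in_cons => /orP[/eqP kj|//].
by rewrite -kj ks in js.
Qed.

(** Cauchy-Schwarz for weights of total mass at most [2], the bound of [sum_binc_bound]. It follows
    from expanding the weighted squares of [v i - S / 2]. *)
Lemma sqr_sum_le2 (I : Type) (s : seq I) (d v : I -> R) :
  (forall i, 0 <= d i) -> \sum_(i <- s) d i <= 2 ->
  (\sum_(i <- s) d i * v i) ^+ 2 <= 2 * \sum_(i <- s) d i * v i ^+ 2.
Proof.
move=> d0 d2; set S := \sum_(i <- s) d i * v i; set Q := \sum_(i <- s) _ * _ ^+ 2.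
have : 0 <= \sum_(i <- s) d i * (v i - S / 2) ^+ 2.
  by apply: sumr_ge0 => i _; rewrite mulr_ge0// sqr_ge0.
have -> : \sum_(i <- s) d i * (v i - S / 2) ^+ 2 =
    Q - S * S + (\sum_(i <- s) d i) * (S / 2) ^+ 2.
  rewrite [RHS](_ : _ = \sum_(i <- s)
      (d i * v i ^+ 2 - d i * v i * S + d i * (S / 2) ^+ 2)).
    by apply: eq_bigr => i _; field.
  by rewrite big_split/= sumrB -!mulr_suml.
set D := \sum_(i <- s) d i in d2 *.
have : D * (S / 2) ^+ 2 <= 2 * (S / 2) ^+ 2 by rewrite ler_wpM2r// sqr_ge0.
have -> : 2 * (S / 2) ^+ 2 = S ^+ 2 / 2 by field.
by rewrite -expr2; lra.
Qed.

Lemma cvg_sum_seq (I : eqType) (s : seq I) (f : I -> nat -> R) (l : I -> R) :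
  (forall i, i \in s -> f i n @[n --> \oo] --> l i) ->
  (\sum_(i <- s) f i n) @[n --> \oo] --> \sum_(i <- s) l i.
Proof.
elim: s => [|i s IH] fl.
  by rewrite big_nil; under eq_fun do rewrite big_nil; exact: cvg_cst.
rewrite big_cons; under eq_fun do rewrite big_cons.
apply: cvgD; first by apply: fl; rewrite mem_head.
by apply: IH => j js; apply: fl; rewrite in_cons js orbT.
Qed.

Lemma sqrD_le2 (x y z : R) : 0 <= x -> 0 <= y -> 0 <= z -> z <= x + y ->
  z ^+ 2 <= 2 * x ^+ 2 + 2 * y ^+ 2.
Proof.
move=> x0 y0 z0 zxy; apply: (@le_trans _ _ ((x + y) ^+ 2)).
  by rewrite ler_sqr ?nnegrE ?addr_ge0.
by rewrite -subr_ge0 (_ : _ - _ = (x - y) ^+ 2) ?sqr_ge0//; ring.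
Qed.

End FiniteSums.

(** The constant term of the series cancels [1], so every remaining term contains a factor
    [1 - X^N], the source of the small constant [kappa]. *)
Lemma powp_expansion {R : realType} (N : nat) (s : R) (K n : nat) :
  'X^n * (1 - powp N s K) =
  - \sum_(k < K) binc s k.+1 *: ('X^n * (1 - 'X^N) ^+ k.+1).
Proof.
rewrite /powp /binp big_ord_recl/= scale1r expr0 rmorphD/= rmorph1.
rewrite opprD addNKr raddf_sum mulrN mulr_sumr; congr (- _).
by apply: eq_bigr => k _; rewrite /bump/= add1n linearZ/= rmorphXn/= comp_polyX scalerAr.
Qed.

Section Observation.
Context {R : realType} {H Y : hilbertType R} (A : {linear H -> H}) (C : {linear H -> Y}).
Hypothesis posA : positive_operator A.
Hypothesis contrA : forall x, hnorm (A x) <= hnorm x.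
Variables (b kC : R).
Hypothesis Cbounded : forall y, hnorm (C y) <= kC * hnorm y.
Hypothesis bessel : forall x N,
  \sum_(n < N) hnorm (C (iter n A x)) ^+ 2 <= b * hnorm x ^+ 2.

(** [A^n q(A) x] is [A^(n - n0)] applied to the fixed vector [A^n0 q(A) x], of norm at most
    [kappa |x|], so the Bessel bound of that vector suffices. *)
Lemma bessel_poly q n0 (kappa : R) (s : seq nat) x : 
  (forall y, 0 <= y <= 1 -> `|('X^n0 * q).[y]| <= kappa) ->
  uniq s -> (forall n, n \in s -> (n0 <= n)%N) ->
  \sum_(n <- s) hnorm (C (rpoly_op A ('X^n * q) x)) ^+ 2 <=
    b * (kappa ^+ 2 * hnorm x ^+ 2).
Proof.
move=> qk us n0s.
have k0 : 0 <= kappa by rewrite (le_trans _ (qk 0 _))// lexx ler01.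
set N := \max_(n <- s) n.+1.
have sN n : n \in s -> (n < N)%N by move=> ns; rewrite /N (leq_bigmax_seq n).
have sub : {subset s <= map (addn n0) (iota 0 N)}.
  move=> n ns; apply/mapP; exists (n - n0)%N; last by rewrite subnKC// n0s.
  by rewrite mem_iota/= add0n (leq_ltn_trans (leq_subr _ _))// sN.
apply: le_trans (ler_sum_uniq_sub (fun=> sqr_ge0 _) us sub) _.
rewrite big_map -[N]subn0 -/(index_iota 0 N) big_mkord.
(* The empty sum in [bessel] gives [0 <= b |x|^2]. *)
have b0 : 0 <= b \/ hnorm x = 0.
  have := bessel x 0; rewrite big_ord0; have [/= ->|x0] := eqVneq x 0.
    by right; rewrite hnorm0.
  by left; move: H0; rewrite pmulr_lge0// exprn_gt0// hnorm_gt0.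
apply: le_trans (_ : b * hnorm (rpoly_op A ('X^n0 * q) x) ^+ 2 <= _).
  apply: le_trans (bessel _ N); apply: ler_sum => n _.
  by rewrite addnC exprD -mulrA rpoly_opM rpoly_opXn.
have h := rpoly_bound posA contrA qk x.
case: b0 => [b0|x0].
  rewrite ler_wpM2l// -exprMn ler_sqr ?nnegrE ?mulr_ge0 ?hnorm_ge0//.
move: h; rewrite x0 mulr0 => h.
have -> : hnorm (rpoly_op A ('X^n0 * q) x) = 0.
  by apply/eqP; rewrite eq_le h hnorm_ge0.
by rewrite expr0n/= !mulr0.
Qed.

(** A pair [(n, s)] stands for the integer [n] and the perturbed time [n + N s]. The bound is proved
    for the polynomials [powp N s K], uniformly in [K], and passes to the limit. The factor [4] is
    [2] from [sqr_sum_le2] times the total weight [2], after the sums over [ps] and [k] are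
    exchanged. *)
Lemma bessel_perturbation (N n0 m : nat) (kappa : R) (ps : seq (nat * R)) x :
  (0 < N)%N -> 0 <= b ->
  (forall y, 0 <= y <= 1 -> `|y ^+ n0 * (1 - y ^+ N)| <= kappa) ->
  (forall p, p \in ps -> (n0 <= p.1)%N /\ 2^-1 <= p.2 <= 1) ->
  (forall n, (count_mem n (map fst ps) <= m)%N) ->
  \sum_(p <- ps) hnorm (C (iter p.1 A x -
      op_power A (p.1%:R + N%:R * p.2) x)) ^+ 2 <=
    4 * m%:R * b * kappa ^+ 2 * hnorm x ^+ 2.
Proof.
move=> N0 b0 kappaP psP psm.
pose w (p : nat * R) K := rpoly_op A ('X^(p.1) * (1 - powp N p.2 K)) x.
pose f (p : nat * R) K := hnorm (C (w p K)) ^+ 2.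
pose l (p : nat * R) := hnorm (C (iter p.1 A x - op_power A (p.1%:R + N%:R * p.2) x)) ^+ 2.
have kC0 (y : H) : 0 <= kC * hnorm y by rewrite (le_trans (hnorm_ge0 _) (Cbounded y)).
have fl p : p \in ps -> f p K @[K --> \oo] --> l p.
  move=> /psP[_ /andP[s2 s1]]; rewrite /f /l.
  have s0 : 0 < p.2 by rewrite (lt_le_trans _ s2).
  apply: (@cvg_comp _ _ _ (fun K => hnorm (C (w p K))) (fun y => y ^+ 2)); last exact: exprn_continuous.
  have wl K : `|hnorm (C (iter p.1 A x - op_power A (p.1%:R + N%:R * p.2) x)) - hnorm (C (w p K))|
      <= kC * hnorm x * binprod p.2 K.
    set L := iter _ _ _ - _.
    have dist : hnorm (w p K - L) <= binprod p.2 K * hnorm x.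
      rewrite /w mulrBr mulr1 rpoly_opB rpoly_opXn /L opprB addrC addrA subrK.
      rewrite -[X in hnorm X]opprB hnorm_opp.
      apply: rpoly_power => //; first by rewrite addr_ge0// mulr_ge0// ltW.
      move=> y y01; rewrite hornerM hornerXn powRD; last first.
        by rewrite gt_eqF// ltr_wpDl// mulr_gt0// ltr0n.
      case/andP: (y01) => y0 y1; rewrite powR_mulrn// -mulrBr normrM.
      apply: le_trans (powp_powR N K _ y01); last by rewrite s0.
      rewrite ler_piMl//; by rewrite normrX ger0_norm// exprn_ile1.
    have kCb : hnorm (C (w p K - L)) <= kC * hnorm x * binprod p.2 K.
      have [x0|x0] := eqVneq (hnorm x) 0.
        move: dist; rewrite x0 !mulr0 => /(conj (hnorm_ge0 _))/andP/le_anti E.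
        by rewrite (le_trans (Cbounded _))// -E !mulr0 mul0r.
      have kC1 : 0 <= kC.
        have := kC0 x; rewrite pmulr_lge0// lt_neqAle eq_sym x0 hnorm_ge0//.
      by rewrite (le_trans (Cbounded _))// -mulrA ler_wpM2l// mulrC.
    apply: le_trans kCb; have -> : C (w p K - L) = C (w p K) - C L by rewrite linearB.
    by rewrite hnorm_distC ler_dist_hnorm.
  apply/cvgrPdist_le => e e0.
  have lim0 : kC * hnorm x * binprod p.2 K @[K --> \oo] --> 0.
    rewrite -[X in _ --> X](mulr0 (kC * hnorm x)); apply: cvgMr.
    by apply: binprod_cvg0; rewrite s0.
  have /cvgrPdist_le/(_ _ e0) := lim0; apply: filterS => K; rewrite sub0r normrN => Ke.
  by rewrite (le_trans (wl K))// (le_trans _ Ke)// ler_norm.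
have fl' := cvg_sum_seq fl.
apply: (ler_cvg_to fl' (cvg_cst _)); apply: nearW => K.
pose d k : R := binprod 2^-1 k / k.+1%:R.
have d0 k : 0 <= d k.
  by rewrite divr_ge0// binprod_ge0// invr_ge0 ler0n/= invf_le1// ler1n.
pose v n k := hnorm (C (rpoly_op A ('X^n * (1 - 'X^N) ^+ k.+1) x)).
have fv p : p \in ps -> f p K <= 2 * \sum_(k < K) d k * v p.1 k ^+ 2.
  move=> /psP[_ p2]; apply: le_trans (sqr_sum_le2 _ _ _) => //; last exact: sum_binc_bound.
  rewrite ler_sqr ?nnegrE ?hnorm_ge0//; last first.
    by apply: sumr_ge0 => k _; rewrite mulr_ge0// hnorm_ge0.
  rewrite /w powp_expansion rpoly_opN linearN hnorm_opp rpoly_op_sum linear_sum.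
  rewrite (le_trans (hnorm_sum _ _))//; apply: ler_sum => k _.
  rewrite rpoly_opZ linearZ hnormZr ler_wpM2r ?hnorm_ge0//.
  exact: binc_bound.
have vs k : \sum_(p <- ps) v p.1 k ^+ 2 <= m%:R * (b * (kappa ^+ 2 * hnorm x ^+ 2)).
  apply: le_trans (sum_multiplicity (h := fun n => v n k ^+ 2) (fun=> sqr_ge0 _) psm) _.
  rewrite ler_wpM2l//; apply: (@bessel_poly _ n0).
  - move=> y y01; have := kappaP y y01; rewrite !hornerE => h.
    (* One factor [1 - y^N] enters [kappa] and the others are at most [1], so the bound is the same
       for all [k]. *)
    rewrite exprS mulrA normrM (le_trans _ h)// ler_piMr//.
    have : 0 <= 1 - y ^+ N <= 1.
      case/andP: y01 => y0 y1.
      by rewrite subr_ge0 exprn_ile1//= gerBl exprn_ge0.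
    move=> /andP[u0 u1]; rewrite normrX ger0_norm// exprn_ile1//.
  - exact: undup_uniq.
  - by move=> n; rewrite mem_undup => /mapP[p /psP[? _] ->].
apply: (@le_trans _ _ (\sum_(p <- ps) 2 * \sum_(k < K) d k * v p.1 k ^+ 2)).
  by rewrite big_seq [leRHS]big_seq ler_sum.
rewrite -mulr_sumr exchange_big/=.
under eq_bigr do rewrite -mulr_sumr.
apply: (@le_trans _ _ (2 * \sum_(k < K) d k * (m%:R * (b * (kappa ^+ 2 * hnorm x ^+ 2))))).
  by rewrite ler_wpM2l// ler_sum// => k _; rewrite ler_wpM2l.
rewrite -mulr_suml; set Z := m%:R * _.
have Z0 : 0 <= Z.
  by rewrite /Z mulr_ge0 ?ler0n// mulr_ge0 ?b0// mulr_ge0 ?sqr_ge0.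
have -> : 4 * m%:R * b * kappa ^+ 2 * hnorm x ^+ 2 = 2 * (2 * Z).
  by rewrite /Z; ring.
by rewrite ler_wpM2l// ler_wpM2r// sum_binc_bound.
Qed.

End Observation.

(** * Gap estimate and Muntz approximation for time sets *)

Section TimeSetLemmas.
Context {R : realType}.

Lemma ler_sum_const (J : eqType) (s : seq J) (h : J -> R) (c : R) (N : nat) :
  0 <= c -> (forall j, j \in s -> h j <= c) -> (size s <= N)%N ->
  \sum_(j <- s) h j <= N%:R * c.
Proof.
move=> c0 hc sN; apply: (@le_trans _ _ ((size s)%:R * c)).
  elim: s hc {sN} => [|j s IH] hc; first by rewrite big_nil mul0r.
  rewrite big_cons /= -nat1r mulrDl mul1r lerD ?hc ?mem_head//.
  by apply: IH => i si; rewrite hc// in_cons si orbT.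
by rewrite ler_wpM2r// ler_nat.
Qed.

(** By geometric sums, [1 - y^N <= N (1 - y)] and [(n + 1) y^n (1 - y) <= 1 - y^(n + 1) <= 1]. *)
Lemma expr_gap_bound (n N : nat) (y : R) : 0 <= y <= 1 ->
  `|y ^+ n * (1 - y ^+ N)| <= N%:R / n.+1%:R.
Proof.
move=> /andP[y0 y1]; have u0 : 0 <= 1 - y by rewrite subr_ge0.
have pow0 k : 0 <= y ^+ k <= 1 by rewrite exprn_ge0// exprn_ile1.
have geo k : 1 - y ^+ k = (1 - y) * \sum_(i < k) y ^+ i.
  by rewrite -[in LHS](expr1n _ k) subrXX; congr (_ * _); apply: eq_bigr => i _; rewrite expr1n mul1r.
rewrite ger0_norm; last first.
  have /andP[h1 h2] := pow0 n; have /andP[h3 h4] := pow0 N.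
  by rewrite mulr_ge0// subr_ge0.
have h1 : 1 - y ^+ N <= N%:R * (1 - y).
  rewrite geo mulrC ler_wpM2r// -[leRHS]mulr1 -[N in leRHS]card_ord -sumr_const mulr_suml.
  by apply: ler_sum => i _; rewrite mul1r; case/andP: (pow0 i).
have h2 : n.+1%:R * (y ^+ n * (1 - y)) <= 1.
  apply: (@le_trans _ _ (1 - y ^+ n.+1)); last by rewrite gerBl exprn_ge0.
  rewrite geo [_ ^+ n * _]mulrC mulrCA ler_wpM2l//.
  rewrite -[n.+1 in leLHS]card_ord -sumr_const mulr_suml; apply: ler_sum => i _.
  by rewrite mul1r ler_wiXn2l// -ltnS.
rewrite ler_pdivlMr//; apply: (@le_trans _ _ (N%:R * (n.+1%:R * (y ^+ n * (1 - y))))).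
  rewrite [n.+1%:R * _]mulrC mulrA ler_wpM2r// mulrCA ler_wpM2l//.
  by case/andP: (pow0 n).
by rewrite -[leRHS]mulr1 ler_wpM2l.
Qed.

Lemma muntz_time_set (T : set R) (P n : nat) (e : R) :
  (forall x, 0 <= x -> exists2 t, T t & x <= t <= x + P%:R) ->
  (0 < n)%N -> 0 < e ->
  exists ts (a : R -> R), (forall t, t \in ts -> T t) /\
    (forall t, t \in ts -> 0 <= t) /\
    forall y, 0 <= y <= 1 -> `|('X^n).[y] - \sum_(t <- ts) a t * y `^ t| <= e.
Proof.
move=> gap n0 e0; have [Tn|Tn] := pselect (T n%:R).
  exists [:: n%:R], (fun=> 1); split; [|split].
  - by move=> t; rewrite inE => /eqP ->.
  - by move=> t; rewrite inE => /eqP ->.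
  - move=> y /andP[y0 _]; rewrite big_seq1 mul1r powR_mulrn// hornerXn subrr.
    by rewrite normr0 ltW.
(* Starting at [n + 1] keeps [n / t j] below [1], and steps longer than [P] make the [t j] increase
   strictly. The growth is linear, [t j <= D (j + 1)], so the Muntz product tends to [0]. *)
pose z j : R := n%:R + 1 + (P%:R + 1) * j%:R.
have z0 j : 0 <= z j by rewrite /z !addr_ge0// mulr_ge0// addr_ge0.
have /choice[t tP] : forall j : nat, exists x : R, T x /\ z j <= x <= z j + P%:R.
  by move=> j; have [x Tx xP] := gap _ (z0 j); exists x.
have tn j : n%:R + 1 <= t j.
  have [_ /andP[h _]] := tP j; rewrite (le_trans _ h)// lerDl mulr_ge0// addr_ge0//.
have tpos j : 0 < t j by rewrite (lt_le_trans _ (tn j))// ltr_wpDl.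
have tlt i j : (i < j)%N -> t i < t j.
  move=> ij; have [_ /andP[_ h1]] := tP i; have [_ /andP[h2 _]] := tP j.
  rewrite (le_lt_trans h1)// (lt_le_trans _ h2)// /z.
  have : (i.+1%:R : R) <= j%:R by rewrite ler_nat.
  rewrite -natr1 => h; have : (P%:R + 1) * (i%:R + 1) <= (P%:R + 1) * j%:R :> R.
    by rewrite ler_wpM2l// addr_ge0.
  by lra.
have tinj : injective t.
  move=> i j tij; have [ij|ij|//] := ltngtP i j.
    by have := tlt _ _ ij; rewrite tij ltxx.
  by have := tlt _ _ ij; rewrite tij ltxx.
pose D : R := n%:R + 1 + P%:R.
have D0 : 0 < D by rewrite /D ltr_wpDr// ltr_wpDl.
pose d : R := n%:R / D.
have d0 : 0 < d by rewrite divr_gt0// ltr0n.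
have aP j : d / j.+1%:R <= n%:R / t j <= 1.
  apply/andP; split; last first.
    by rewrite ler_pdivrMr// mul1r (le_trans _ (tn j))// lerDl.
  rewrite /d -mulrA ler_wpM2l// -invfM lef_pV2 ?posrE ?mulr_gt0//.
  have [_ /andP[_ h]] := tP j; rewrite (le_trans h)// /z /D -natr1.
  have : 0 <= n%:R * j%:R :> R by rewrite mulr_ge0.
  by lra.
have /cvgrPdist_le/(_ _ e0)[K _ /(_ K (leqnn K))] := prod_cvg0 d0 aP.
rewrite /= sub0r normrN => Ke.
pose ts := map t (iota 0 K).
have tsP x : x \in ts -> exists j, x = t j by move=> /mapP[j _ ->]; exists j.
have [||||a ha] := @muntz_bound R n%:R ts.
- by rewrite ltr0n.
- by rewrite map_inj_uniq// iota_uniq.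
- apply/negP => /tsP[j E]; have := tn j; rewrite -E; lra.
- by move=> x /tsP[j ->].
exists ts, a; split; [|split].
- by move=> x /tsP[j ->]; have [] := tP j.
- by move=> x /tsP[j ->]; exact: ltW.
move=> y y01; rewrite hornerXn -powR_mulrn; last by case/andP: y01.
apply: le_trans (ha y y01) _; apply: le_trans Ke; rewrite le_eqVlt; apply/orP; left.
rewrite normr_prod big_map -[K in iota 0 K]subn0 -/(index_iota 0 K) big_mkord.
by [].
Qed.

End TimeSetLemmas.

(** * Observation bounds along the time set *)

Section ObservationAlongT.
Context {R : realType} {H Y : hilbertType R} (A : {linear H -> H}) (C : {linear H -> Y}).
Hypothesis posA : positive_operator A.
Hypothesis contrA : forall x, hnorm (A x) <= hnorm x.
Variables (b kC : R).
Hypothesis b0 : 0 <= b.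
Hypothesis kC0 : 0 <= kC.
Hypothesis Cbounded : forall y, hnorm (C y) <= kC * hnorm y.
Hypothesis bessel : forall x N,
  \sum_(n < N) hnorm (C (iter n A x)) ^+ 2 <= b * hnorm x ^+ 2.
Variable T : set R.

Let obs t x := hnorm (C (op_power A t x)) ^+ 2.

Let obs_split n t x :
  obs t x <= 2 * hnorm (C (iter n A x)) ^+ 2
    + 2 * hnorm (C (iter n A x - op_power A t x)) ^+ 2.
Proof.
apply: sqrD_le2; rewrite ?hnorm_ge0// linearB.
set u := C (iter n A x); set v := C _.
have E : v = u - (u - v) by rewrite opprB addrCA subrr addr0.
by rewrite {1}E (le_trans (ler_hnormD _ _))// hnorm_opp.
Qed.

Let nat_split n t x :
  hnorm (C (iter n A x)) ^+ 2 <= 2 * obs t x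
    + 2 * hnorm (C (iter n A x - op_power A t x)) ^+ 2.
Proof.
apply: sqrD_le2; rewrite ?hnorm_ge0// linearB.
by rewrite addrC (le_trans _ (ler_hnormD _ _))// subrK.
Qed.

Lemma observation_upper (N : nat) (F : seq R) x :
  (forall t, T t -> 0 <= t) ->
  (forall y s, 0 <= y -> uniq s -> (forall t, t \in s -> T t /\ y <= t <= y + 1) ->
     (size s <= N)%N) ->
  uniq F -> (forall t, t \in F -> T t) ->
  \sum_(t <- F) obs t x <= (N%:R * kC ^+ 2 + 10 * N%:R * b) * hnorm x ^+ 2.
Proof.
(* The at most [N] times below [1] are bounded directly by the norm of [C]; no natural number lies
   at distance at least [1] below them. *)
move=> T0 TN uF FT; rewrite (bigID (fun t => t < 1))/= mulrDl lerD//.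
  rewrite -big_filter -mulrA; apply: ler_sum_const.
  - by rewrite mulr_ge0 ?sqr_ge0.
  - move=> t; rewrite mem_filter => /andP[_ /FT/T0 t0].
    rewrite /obs -exprMn ler_sqr ?nnegrE ?mulr_ge0 ?hnorm_ge0//.
    rewrite (le_trans (Cbounded _))// ler_wpM2l//.
    exact: op_power_le.
  - apply: (TN 0) => //; first exact: filter_uniq.
    move=> t; rewrite mem_filter => /andP[t1 /FT Tt]; split => //.
    by rewrite T0//= add0r ltW.
rewrite -big_filter; set s := [seq t <- F | _].
have sP t : t \in s -> T t /\ 1 <= t.
  by rewrite mem_filter -leNgt => /andP[t1 /FT].
have us : uniq s by exact: filter_uniq.
(* The predecessor puts [t - n t] in [[1, 2]], that is [sg t] in [[1/2, 1]], as
   [bessel_perturbation] requires with period [2]. *)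
pose n (t : R) : nat := (Num.truncn t).-1.
pose sg (t : R) : R := (t - (n t)%:R) / 2.
have nP t : 1 <= t -> (n t)%:R + 1 <= t <= (n t)%:R + 1 + 1.
  move=> t1; have t0 : 0 <= t by rewrite (le_trans _ t1).
  have /andP[h1 h2] := truncn_itv t0.
  have k1 : (0 < Num.truncn t)%N by rewrite truncn_gt0.
  rewrite /n natr1 prednK// h1/= natr1 ltW//.
have tE t : t = (n t)%:R + 2 * sg t by rewrite /sg; field.
have cnt j : (count_mem j (map n s) <= N)%N.
  rewrite count_map -size_filter; apply: (TN (j%:R + 1)).
  - by rewrite addr_ge0.
  - exact: filter_uniq.
  - move=> t; rewrite mem_filter => /andP[/= /eqP <- /sP[Tt t1]]; split => //.
    exact: nP.
apply: (@le_trans _ _ (\sum_(t <- s) (2 * hnorm (C (iter (n t) A x)) ^+ 2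
    + 2 * hnorm (C (iter (n t) A x - op_power A t x)) ^+ 2))).
  by apply: ler_sum => t _; exact: obs_split.
rewrite big_split/= -!mulr_sumr.
have -> : 10 * N%:R * b * hnorm x ^+ 2 = 2 * (N%:R * (b * hnorm x ^+ 2))
    + 2 * (4 * N%:R * b * 1 ^+ 2 * hnorm x ^+ 2) by ring.
rewrite lerD// ler_wpM2l//.
  apply: le_trans (sum_multiplicity (h := fun n => hnorm (C (iter n A x)) ^+ 2) (fun=> sqr_ge0 _) cnt) _.
  rewrite ler_wpM2l//.
  have := @bessel_poly _ _ _ A C posA contrA b bessel 1 0 1 (undup (map n s)) x.
  rewrite expr1n mul1r; under eq_bigr do rewrite mulr1 rpoly_opXn.
  apply; rewrite ?undup_uniq// => y _; by rewrite mulr1 hornerE normr1.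
pose ps := map (fun t => (n t, sg t)) s.
have := @bessel_perturbation _ _ _ A C posA contrA b kC Cbounded bessel
  2 0 N 1 ps x isT b0.
rewrite big_map/=.
under eq_bigr do rewrite -tE; apply.
- move=> y /andP[y0 y1]; rewrite mul1r.
  by rewrite ger0_norm ?subr_ge0 ?exprn_ile1// gerBl exprn_ge0.
- move=> p /mapP[t /sP[_ t1] ->] /=; split => //.
  have /andP[h1 h2] := nP t t1; rewrite /sg; apply/andP; split; lra.
- by move=> j; rewrite -map_comp.
Qed.

Hypothesis T0 : T 0.
Variable P : nat.
Hypothesis P0 : (0 < P)%N.
Hypothesis gap : forall x, 0 <= x -> exists2 t, T t & x <= t <= x + P%:R.

(** For [n > 0], [A^n] is within a small norm error of a finite combination of the [A^t], and [L]
    comes from its coefficients. For [n = 0] no combination of positive powers would do, since these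
    vanish at [l = 0]; the time [0] of [T] observes this term directly. *)
Lemma observation_head n (e : R) : 0 < e -> exists2 L : R, 0 <= L &
  forall x tau, (forall t, T t -> obs t x <= tau) ->
    hnorm (C (iter n A x)) ^+ 2 <= e * hnorm x ^+ 2 + L * tau.
Proof.
move=> e0; case: n => [|n].
  exists 1 => // x tau /(_ _ T0); rewrite /obs /op_power eqxx mul1r.
  move=> /le_trans; apply; rewrite lerDr mulr_ge0 ?sqr_ge0// ltW//.
(* The [2] compensates [sqrD_le2] and [kC^2] the norm of [C]; the [1] keeps the denominator
   positive. *)
pose eta2 := e / (2 * (kC ^+ 2 + 1)).
have k1 : 0 < kC ^+ 2 + 1 by rewrite ltr_wpDl// sqr_ge0.
have eta20 : 0 < eta2 by rewrite divr_gt0// mulr_gt0.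
pose eta := Num.sqrt eta2.
have eta0 : 0 < eta by rewrite sqrtr_gt0.
have [ts [a [tsT [ts0 tsa]]]] := muntz_time_set gap (ltn0Sn n) eta0.
pose S := \sum_(t <- ts) `|a t|.
have S0 : 0 <= S by apply: sumr_ge0.
exists (2 * S ^+ 2); first by rewrite mulr_ge0// sqr_ge0.
move=> x tau xtau.
have tau0 : 0 <= tau by rewrite (le_trans _ (xtau 0 T0))// sqr_ge0.
have h1 := rpoly_power_sum posA contrA ts0 tsa x.
rewrite rpoly_opXn in h1; set W := \sum_(t <- ts) _ in h1.
have h2 : hnorm (C W) <= S * Num.sqrt tau.
  rewrite /W linear_sum (le_trans (hnorm_sum _ _))// /S mulr_suml.
  rewrite big_seq [leRHS]big_seq; apply: ler_sum => t tts.
  rewrite linearZ hnormZr ler_wpM2l//.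
  rewrite -[hnorm _]ger0_norm ?hnorm_ge0// -sqrtr_sqr ler_sqrt//.
  exact: xtau (tsT _ tts).
have h3 : hnorm (C (iter n.+1 A x)) <= kC * (eta * hnorm x) + S * Num.sqrt tau.
  rewrite -[iter n.+1 A x](subrK W) linearD (le_trans (ler_hnormD _ _))// lerD//.
  by rewrite (le_trans (Cbounded _))// ler_wpM2l.
apply: le_trans (sqrD_le2 _ _ (hnorm_ge0 _) h3) _.
- by rewrite !mulr_ge0 ?hnorm_ge0// ltW.
- by rewrite mulr_ge0// sqrtr_ge0.
rewrite !exprMn !sqr_sqrtr ?(ltW eta20)// -[2 * S ^+ 2 * tau]mulrA lerD2r.
set X := hnorm x ^+ 2.
have -> : 2 * (kC ^+ 2 * (eta2 * X)) = e * (kC ^+ 2 / (kC ^+ 2 + 1)) * X.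
  by rewrite /eta2; field; rewrite gt_eqF.
rewrite ler_wpM2r ?sqr_ge0//.
by rewrite ler_piMr ?(ltW e0)// ler_pdivrMr// mul1r lerDl.
Qed.

(** The gap hypothesis at [n + P] gives a time [t n] in [[n + P, n + 2P]], hence a parameter in
    [[1/2, 1]] for the period [2P]. Each [n] occurs once in the perturbation, but one time may serve
    up to [2P + 1] integers. *)
Lemma observation_tail n0 N x tau :
  (forall F, uniq F -> (forall t, t \in F -> T t) -> \sum_(t <- F) obs t x <= tau) ->
  \sum_(n < N) hnorm (C (iter (n0 + n) A x)) ^+ 2 <=
    2 * ((2 * P).+1%:R * tau) + 8 * b * ((2 * P)%:R / n0.+1%:R) ^+ 2 * hnorm x ^+ 2.
Proof.
move=> Ftau.
have /choice[t tP] : forall n : nat, exists y : R, T y /\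
    n%:R + P%:R <= y <= n%:R + P%:R + P%:R.
  move=> n; have [|y Ty yP] := gap (x := n%:R + P%:R); first by rewrite addr_ge0.
  by exists y.
set s := iota n0 N.
have -> : \sum_(n < N) hnorm (C (iter (n0 + n) A x)) ^+ 2 =
    \sum_(n <- s) hnorm (C (iter n A x)) ^+ 2.
  by rewrite /s -[n0]addn0 iotaDl big_map addn0 -[N in iota 0 N]subn0 -/(index_iota 0 N) big_mkord.
apply: (@le_trans _ _ (\sum_(n <- s) (2 * obs (t n) x +
   2 * hnorm (C (iter n A x - op_power A (t n) x)) ^+ 2))).
  by apply: ler_sum => n _; exact: nat_split.
rewrite big_split/= -!mulr_sumr.
set kappa := (2 * P)%:R / _.
have -> : 8 * b * kappa ^+ 2 * hnorm x ^+ 2 =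
    2 * (4 * 1%:R * b * kappa ^+ 2 * hnorm x ^+ 2) by ring.
have P2 : (0 : R) < (2 * P)%:R by rewrite ltr0n muln_gt0.
rewrite lerD// ler_wpM2l//.
  apply: le_trans (sum_multiplicity (h := fun t => obs t x) (m := (2 * P).+1) (fun=> sqr_ge0 _) _) _.
    move=> j; rewrite count_map -size_filter.
    set M := Num.truncn j.
    (* [t n = j] puts [n] in [[j - 2P, j - P]], which is covered by [2P + 1] consecutive integers
       from [M - 2P] on, or from [0] on if that is negative. *)
    rewrite -(size_iota (M - 2 * P) (2 * P).+1); apply: uniq_leq_size.
      by rewrite filter_uniq// iota_uniq.
    move=> n; rewrite mem_filter => /andP[/= /eqP tj _].
    have [_ /andP[h1 h2]] := tP n; rewrite tj in h1 h2.
    have j0 : 0 <= j by rewrite (le_trans _ h1)// addr_ge0.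
    have /andP[h3 h4] := truncn_itv j0; rewrite -/M in h3 h4.
    have nM : (n < M.+1)%N.
      by rewrite -(ltr_nat R) (le_lt_trans _ h4)// (le_trans _ h1)// lerDl.
    have Mn : (M <= n + 2 * P)%N.
      rewrite -(ler_nat R) (le_trans h3)// (le_trans h2)// natrD mul2n -addnn natrD; lra.
    rewrite -[_ :: _]/(iota (M - 2 * P) (2 * P).+1) mem_iota; lia.
  rewrite ler_wpM2l//; apply: Ftau; first exact: undup_uniq.
  by move=> y; rewrite mem_undup => /mapP[n _ ->]; have [] := tP n.
pose ps := map (fun n => (n, (t n - n%:R) / (2 * P)%:R)) s.
have := @bessel_perturbation _ _ _ A C posA contrA b kC Cbounded bessel
  (2 * P) n0 1 kappa ps x _ b0.
rewrite big_map/= muln_gt0 P0.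
have tE j : j%:R + (2 * P)%:R * ((t j - j%:R) / (2 * P)%:R) = t j.
  by rewrite [_ * (_ / _)]mulrC divfK ?gt_eqF// addrC subrK.
under eq_bigr do rewrite tE.
apply => //.
- by move=> y y01; exact: expr_gap_bound.
- move=> p /mapP[n]; rewrite mem_iota => /andP[n0n _] ->; split => //=.
  have [_ /andP[h1 h2]] := tP n.
  by rewrite ler_pdivlMr// ler_pdivrMr// !natrM; apply/andP; split; lra.
- by move=> j; rewrite -map_comp map_id count_uniq_mem ?iota_uniq// leq_b1.
Qed.

(** Tail and head each lose at most a quarter of [a |x|^2], so half of it remains to be bounded by a
    multiple of [tau]. *)
Lemma observation_lower (a : R) : 0 < a ->
  (forall x B, (forall N, \sum_(n < N) hnorm (C (iter n A x)) ^+ 2 <= B) ->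
     a * hnorm x ^+ 2 <= B) ->
  exists2 a' : R, 0 < a' & forall x tau,
    (forall F, uniq F -> (forall t, t \in F -> T t) -> \sum_(t <- F) obs t x <= tau) ->
    a' * hnorm x ^+ 2 <= tau.
Proof.
move=> a0 lower.
have [n0 n0P] : exists n0 : nat, 8 * b * ((2 * P)%:R / n0.+1%:R) ^+ 2 <= a / 4.
  pose Q : R := 8 * b * (2 * P)%:R ^+ 2.
  have Q0 : 0 <= Q by rewrite !mulr_ge0// sqr_ge0.
  (* Its successor [n] exceeds [4 Q / a], and [n <= n^2] then gives [Q / n^2 <= a / 4]. *)
  exists (Num.truncn (4 * Q / a)).
  have := truncnS_gt (4 * Q / a); set n := (Num.truncn _).+1 => Qn.
  have n1 : (0 : R) < n%:R by rewrite ltr0n.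
  have nn : (n%:R : R) <= n%:R ^+ 2 by rewrite expr2 ler_peMr// ler1n.
  rewrite exprMn exprVn mulrA -/Q ler_pdivrMr ?exprn_gt0//.
  have h1 : 4 * Q < n%:R * a by rewrite -ltr_pdivrMr.
  have h2 : n%:R * a <= n%:R ^+ 2 * a by rewrite ler_wpM2r// ltW.
  by lra.
pose e := a / (4 * n0.+1%:R).
have e0 : 0 < e by rewrite divr_gt0// mulr_gt0.
have [L L0 hL] : exists2 L : R, 0 <= L & forall x tau, (forall t, T t -> obs t x <= tau) ->
    \sum_(n < n0) hnorm (C (iter n A x)) ^+ 2 <= n0%:R * (e * hnorm x ^+ 2) + L * tau.
  move: (n0) (e) e0 => m d d0; elim: m => [|m [L1 L10 h1]].
    by exists 0 => // x tau _; rewrite big_ord0 !mul0r addr0.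
  have [L2 L20 h2] := observation_head m d0.
  exists (L1 + L2); first exact: addr_ge0.
  move=> x tau xt; rewrite big_ord_recr/= -natr1 !mulrDl mul1r addrACA.
  by rewrite lerD ?h1 ?h2.
pose K := L + 2 * (2 * P).+1%:R.
have K0 : 0 < K by rewrite /K ltr_wpDl// mulr_gt0.
exists (a / (2 * K)); first by rewrite divr_gt0// mulr_gt0.
move=> x tau Ftau.
have h : a * hnorm x ^+ 2 <= a / 2 * hnorm x ^+ 2 + K * tau.
  apply: lower => N; apply: (@le_trans _ _ (\sum_(n < n0 + N) hnorm (C (iter n A x)) ^+ 2)).
    rewrite addnC big_split_ord/= lerDl; apply: sumr_ge0 => i _; exact: sqr_ge0.
  rewrite big_split_ord/=.
  have h1 := hL x tau _.
  have h2 := observation_tail n0 N Ftau.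
  apply: le_trans (lerD (h1 _) h2) _.
    by move=> t Tt; have := Ftau [:: t] isT; rewrite big_seq1; apply => s; rewrite inE => /eqP ->.
  have h3 : n0%:R * (e * hnorm x ^+ 2) <= a / 4 * hnorm x ^+ 2.
    rewrite mulrA ler_wpM2r ?sqr_ge0// /e.
    have -> : n0%:R * (a / (4 * n0.+1%:R)) = a / 4 * (n0%:R / n0.+1%:R).
      by field; rewrite nat1r pnatr_eq0.
    by rewrite ler_piMr ?divr_ge0 ?(ltW a0)// ler_pdivrMr// mul1r ler_nat.
  have h4 : 8 * b * ((2 * P)%:R / n0.+1%:R) ^+ 2 * hnorm x ^+ 2 <= a / 4 * hnorm x ^+ 2.
    by rewrite ler_wpM2r ?sqr_ge0.
  move: (hnorm x ^+ 2) ((2 * P).+1%:R) @K K0 h3 h4 => X c K _ h3 h4.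
  have -> : a / 2 * X + K * tau = (a / 4 * X + L * tau) + (2 * (c * tau) + a / 4 * X).
    by rewrite /K; field.
  by rewrite lerD// ?lerD2r ?lerD2l.
have -> : a / (2 * K) * hnorm x ^+ 2 = (a / 2 * hnorm x ^+ 2) / K by field; rewrite gt_eqF.
by rewrite ler_pdivrMr// mulrC; lra.
Qed.

End ObservationAlongT.

(** * Beurling densities *)

Section Densities.
Context {R : realType}.
Implicit Types T : set R.

(** For some length [r > 0] the infimum of the window densities is positive, while an empty window
    has density [0]. *)
Lemma lower_density_gap T : (0 < lower_density T)%E ->
  exists2 P : nat, (0 < P)%N &
    forall x, 0 <= x -> exists2 t, T t & x <= t <= x + P%:R.
Proof.
rewrite /lower_density limf_einfE => /ereal_sup_gt[_ [V FV <-] V0].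
have [r r0 Vr] := pinfty_ex_gt0 FV.
exists (Num.truncn r).+1 => // x x0; apply/not_exists2P => gapx.
have : (0 < window_density T r x)%E.
  apply: lt_le_trans V0 _; apply: (@le_trans _ _ (ereal_inf [set window_density T r x | x in `[0, +oo[])).
    by apply: ereal_inf_lbound; exists r.
  by apply: ereal_inf_lbound; exists x => //=; rewrite in_itv/= x0.
rewrite /window_density (_ : T `&` _ = set0); last first.
  apply/seteqP; split=> // t [Tt]; rewrite /= in_itv/= => /andP[xt tx].
  have [//|] := gapx t; apply; rewrite xt/= (le_trans tx)// lerD2l ltW//.
  exact: truncnS_gt.
by rewrite /counting; case: asboolP => [_|[]//]; rewrite fset_set0/= mul0e ltxx.
Qed.

Lemma window_count T (r x c : R) : 0 < r -> (window_density T r x <= c%:E)%E ->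
  forall s, uniq s -> (forall t, t \in s -> T t /\ x <= t <= x + r) ->
  (size s)%:R <= c * r.
Proof.
move=> r0; rewrite /window_density /counting; case: asboolP => [fT|_]; last first.
  by rewrite gt0_mulye ?lte_fin ?invr_gt0.
rewrite -EFinM lee_fin ler_pdivrMr// => sc s us sT.
rewrite (le_trans _ sc)// ler_nat; apply: uniq_leq_size => // t ts.
have [Tt xt] := sT t ts.
by rewrite in_fset_set// inE/=; split => //=; rewrite in_itv.
Qed.

(** For some length [r > 1] the window densities are bounded by some [c], and a unit window sits in
    one of length [r], with at most [c r] points. *)
Lemma upper_density_count T : (upper_density T < +oo)%E ->
  exists N : nat, forall x s, 0 <= x -> uniq s ->
    (forall t, t \in s -> T t /\ x <= t <= x + 1) -> (size s <= N)%N.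
Proof.
rewrite /upper_density /limf_esup => /ereal_inf_lt[_ [V FV <-] Voo].
have [r r1 Vr] := pinfty_ex_gt (num_real 1) FV.
have r0 : 0 < r by rewrite (lt_trans _ r1).
set S := ereal_sup _ in Voo.
have [c Vc] : exists c : R, (S <= c%:E)%E.
  by case: (S) Voo => [c _|//|_]; [exists c|exists 0; rewrite leNye].
exists (Num.truncn (c * r)).+1 => x s x0 us sT.
rewrite -(ler_nat R) (le_trans _ (ltW (truncnS_gt _)))//.
apply: (@window_count T r x c) => //; last first.
  move=> t /sT[Tt /andP[xt tx]]; split => //; rewrite xt (le_trans tx)//.
  by rewrite lerD2l ltW.
apply: le_trans Vc; apply: (@le_trans _ _ (ereal_sup [set window_density T r x | x in `[0, +oo[])).
  by apply: ereal_sup_ubound; exists x => //=; rewrite in_itv/= x0.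
by apply: ereal_sup_ubound; exists r.
Qed.

Lemma esum_leP T (h : R -> R) (B : R) :
  (forall F, uniq F -> (forall t, t \in F -> T t) -> \sum_(t <- F) h t <= B) ->
  (\esum_(t in T) (h t)%:E <= B%:E)%E.
Proof.
move=> hB; apply: ge_ereal_sup => _ [F [finF FT] <-].
rewrite fsbig_finite//= sumEFin lee_fin; apply: hB; first exact: finmap.fset_uniq.
by move=> t; rewrite in_fset_set// inE => /FT.
Qed.

Lemma sum_le_esum T (h : R -> R) F : uniq F -> (forall t, t \in F -> T t) ->
  ((\sum_(t <- F) h t)%:E <= \esum_(t in T) (h t)%:E)%E.
Proof.
move=> uF FT; apply: esum_ge; exists [set` F].
  by split; [exact: finite_seq|move=> t /=; exact: FT].
by rewrite -fsbig_seq// sumEFin.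
Qed.

Lemma esum_naturals (h : R -> R) : (forall t, 0 <= h t) ->
  \esum_(t in naturals) (h t)%:E = (\sum_(0 <= n <oo) (h n%:R)%:E)%E.
Proof.
move=> h0; rewrite /naturals esum_set_image.
- by apply: eq_eseriesl => n; rewrite in_setT.
- by move=> n _; rewrite lee_fin.
- by move=> n m _ _ /eqP; rewrite eqr_nat => /eqP.
Qed.

Lemma sum_le_esum_naturals (h : R -> R) N : (forall t, 0 <= h t) ->
  ((\sum_(n < N) h n%:R)%:E <= \esum_(t in naturals) (h t)%:E)%E.
Proof.
move=> h0; rewrite esum_naturals// -sumEFin -(big_mkord xpredT (fun n => (h n%:R)%:E)).
by apply: nneseries_lim_ge => n _ _; rewrite lee_fin.
Qed.

Lemma esum_naturals_le (h : R -> R) (B : R) : (forall t, 0 <= h t) ->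
  (forall N, \sum_(n < N) h n%:R <= B) -> (\esum_(t in naturals) (h t)%:E <= B%:E)%E.
Proof.
move=> h0 hB; rewrite esum_naturals//; apply: lime_le.
  by apply: is_cvg_nneseries => n _ _; rewrite lee_fin.
by apply: nearW => N; rewrite sumEFin lee_fin big_mkord.
Qed.

End Densities.

(** * Power-bounded self-adjoint operators *)

Section Contraction.
Context {R : realType} {H : hilbertType R} (A : {linear H -> H}).

Lemma bernoulli_ineq (d : R) n : 0 <= d -> 1 + n%:R * d <= (1 + d) ^+ n.
Proof.
move=> d0; elim: n => [|n IH]; first by rewrite mul0r addr0.
have h : (1 + d) * (1 + n%:R * d) <= (1 + d) * (1 + d) ^+ n by rewrite ler_wpM2l ?addr_ge0.
rewrite exprS (le_trans _ h)// -natr1.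
have : 0 <= n%:R * d * d by rewrite !mulr_ge0.
by lra.
Qed.

(* [n |-> hnorm (A^n x)] is log-convex because [A] is self-adjoint, so it is
   unbounded as soon as it increases once. *)
Lemma power_bounded_contraction (M : R) :
  (forall x y, inner (A x) y = inner x (A y)) ->
  (forall n x, hnorm (iter n A x) <= M * hnorm x) ->
  forall x, hnorm (A x) <= hnorm x.
Proof.
move=> adjA AM x; rewrite leNgt; apply/negP => xA.
have x0 : 0 < hnorm x.
  rewrite lt_neqAle hnorm_ge0 andbT; apply/eqP => x0.
  have : x == 0 by rewrite -[_ == _]negbK -hnorm_gt0 -x0 ltxx.
  by move=> /eqP E; move: xA; rewrite E linear0 ltxx.
have sq y : hnorm (A y) ^+ 2 <= hnorm (A (A y)) * hnorm y.
  have := cauchy_schwarz (A (A y)) y; rewrite adjA innerxx/=.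
  by rewrite ger0_norm ?sqr_ge0.
pose d := hnorm (A x) / hnorm x - 1.
have d0 : 0 < d by rewrite subr_gt0 ltr_pdivlMr// mul1r.
have grow n : 0 < hnorm (iter n A x) /\ (1 + d) * hnorm (iter n A x) <= hnorm (iter n.+1 A x).
  elim: n => [|n [p IH]] /=.
    by split => //; rewrite /d addrC subrK divfK// gt_eqF.
  have d1 : 0 < 1 + d by rewrite addr_gt0.
  have p1 : 0 < hnorm (A (iter n A x)) by rewrite (lt_le_trans _ IH)// mulr_gt0.
  split => //; have := sq (iter n A x) => h.
  rewrite -(ler_pM2r p) (le_trans _ h)// mulrAC expr2 ler_wpM2r// ltW//.
have pow n : (1 + d) ^+ n * hnorm x <= hnorm (iter n A x).
  elim: n => [|n IH]; first by rewrite mul1r.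
  have [_ h] := grow n; rewrite (le_trans _ h)// exprS -mulrA ler_wpM2l// addr_ge0// ltW//.
have M0 : 0 <= M by have := AM 0%N x; rewrite /= -[X in X <= _]mul1r ler_pM2r//; apply: le_trans.
have := truncnS_gt (M / d); set n := (Num.truncn _).+1 => Mn.
have h : (1 + d) ^+ n <= M by rewrite -(ler_pM2r x0) (le_trans (pow n)).
have := bernoulli_ineq n (ltW d0) => h2.
move: Mn; rewrite ltr_pdivrMr// => Mn; lra.
Qed.

End Contraction.

Theorem theorem4p6 (R : realType) (T : set R) :
  T `<=` `[0, +oo[ -> locally_finite T -> T 0 ->
  (0 < lower_density T)%E -> (lower_density T <= upper_density T)%E ->
  (upper_density T < +oo)%E ->
  universal_time_set T.
Proof.
move=> Tpos lfT T0 /lower_density_gap[P P0 gap] _ /upper_density_count[N TN].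
split => // H Y A C _ _ posA cC [a [b [a0 ab obsAB]]].
have b0 : 0 < b by rewrite (lt_le_trans a0).
have T_ge0 t : T t -> 0 <= t by move=> /Tpos; rewrite /= in_itv/= andbT.
have sq0 (x : H) (t : R) : 0 <= hnorm (C (op_power A t x)) ^+ 2 by exact: sqr_ge0.
have sumE M (x : H) : \sum_(n < M) hnorm (C (op_power A n%:R x)) ^+ 2 =
    \sum_(n < M) hnorm (C (iter n A x)) ^+ 2.
  by apply: eq_bigr => n _; rewrite op_power_nat.
have bessel x M : \sum_(n < M) hnorm (C (iter n A x)) ^+ 2 <= b * hnorm x ^+ 2.
  have /andP[_ h] := obsAB x; rewrite -lee_fin (le_trans _ h)// -sumE.
  exact: (sum_le_esum_naturals M (sq0 x)).
have lower x B : (forall M, \sum_(n < M) hnorm (C (iter n A x)) ^+ 2 <= B) ->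
    a * hnorm x ^+ 2 <= B.
  move=> xB; have /andP[h _] := obsAB x; rewrite -lee_fin (le_trans h)//.
  by apply: (esum_naturals_le (sq0 x)) => M; rewrite sumE.
(* The lower bound at [A^n x] and the upper bound at [x] give [a |A^n x|^2 <= b |x|^2] for all
   [n]. *)
have contrA : forall x, hnorm (A x) <= hnorm x.
  apply: (@power_bounded_contraction _ _ _ (Num.sqrt (b / a)) (positive_adj posA)).
  move=> n x; have ba0 : 0 <= b / a by rewrite divr_ge0 ?ltW.
  rewrite -ler_sqr ?nnegrE ?mulr_ge0 ?hnorm_ge0 ?sqrtr_ge0// exprMn sqr_sqrtr//.
  rewrite mulrAC ler_pdivlMr// mulrC; apply: lower => M.
  apply: le_trans (bessel x (n + M)%N); rewrite big_split_ord/= addrC.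
  rewrite -[X in X <= _]addr0 lerD//; last by apply: sumr_ge0 => i _; exact: sqr_ge0.
  by apply: ler_sum => i _; rewrite addnC iterD.
have [kC kC0 Cbd] := linear_bounded cC.
have upper x F := @observation_upper _ _ _ A C posA contrA b kC (ltW b0) (ltW kC0) Cbd bessel T N F x
  T_ge0 TN.
have [a' a'0 lowerT] := @observation_lower _ _ _ A C posA contrA b kC (ltW b0) (ltW kC0) Cbd bessel T
  T0 P P0 gap a a0 lower.
set b' := (N%:R * kC ^+ 2 + 10 * N%:R * b) in upper.
(* The maximum orders the constants also when [H] is zero, where the two estimates do not compare
   them. *)
exists a', (Num.max a' b'); split => //; first by rewrite le_max lexx.
move=> x.
have up : (\esum_(t in T) (hnorm (C (op_power A t x)) ^+ 2)%:E <= (b' * hnorm x ^+ 2)%:E)%E.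
  by apply: esum_leP => F; exact: upper.
apply/andP; split; last first.
  by rewrite (le_trans up)// lee_fin ler_wpM2r ?sqr_ge0// le_max lexx orbT.
(* [lowerT] is used with [tau] equal to the whole sum over [T], which is a real number by [up]. *)
have fin : \esum_(t in T) (hnorm (C (op_power A t x)) ^+ 2)%:E \is a fin_num.
  rewrite ge0_fin_numE ?(le_lt_trans up) ?ltry//.
  by apply: esum_ge0 => t _; rewrite lee_fin.
rewrite -(fineK fin) lee_fin; apply: lowerT => F uF FT.
by rewrite -lee_fin fineK//; exact: sum_le_esum.
Qed.
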